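(* Let $X$ be a separable (real or complex) rearrangement invariant space on $[0,1]$. If $X$ is lush, then $X=L_1[0,1]$ (with its canonical norm).
   Context: $[0,1]$ carries Lebesgue measure $\mu$. A Köthe function space on $[0,1]$ is a real or complex Banach space $X$ of equivalence classes, modulo equality a.e., of integrable scalar functions such that: (i) if $|f|\le|g|$ a.e. with $f$ measurable and $g\in X$, then $f\in X$ and $\|f\|\le\|g\|$; (ii) $\boldsymbol{1}_A\in X$ for every measurable $A\subset[0,1]$. $X'\subset X^*$ denotes the space of integrals, i.e. functionals $f\mapsto\int fg\,d\mu$ with $g$ measurable and $gf\in L_1$ for all $f\in X$ (identified with $g$), with the norm of $X^*$; it is again a Köthe function space, and $X''=(X')'$. A Köthe function space $X$ on $[0,1]$ is rearrangement invariant (r.i.) if: (1) for every measure-preserving bijection $\tau$ of $[0,1]$ and integrable $f$, $f\in X$ iff $f\tau^{-1}\in X$, and then $\|f\|=\|f\tau^{-1}\|$; (2) $X'$ is a norming subspace of $X^*$ (so $X$ is isometrically a subspace of $X''$), and $X=X''$ or $X$ is the closed linear span of the simple integrable functions of $X''$; (3) $L_\infty[0,1]\subset X\subset L_1[0,1]$ with $\|f\|_X\le\|f\|_\infty$ for $f\in L_\infty[0,1]$ and $\|f\|_1\le\|f\|_X$ for $f\in X$. The equality $X=L_1[0,1]$ means equality as sets of functions with equal norms. A Banach space $X$ is lush if for all $x,y\in S_X$ and $\varepsilon>0$ there is $x^*\in S_{X^*}$ such that $x\in S:=\{z\in B_X:\operatorname{Re}x^*(z)>1-\varepsilon\}$ and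 $\operatorname{dist}(y,\overline{\mathrm{aconv}}(S))<\varepsilon$, where $\overline{\mathrm{aconv}}(S)$ is the closed convex hull of $\{\theta z: |\theta|=1, z\in S\}$ ($\theta$ scalar), and $B_X,S_X$ are the closed unit ball and unit sphere. *)

(* Defs.v *)
From HB Require Import structures.
From mathcomp Require Import all_boot all_order all_algebra.
From mathcomp Require Import complex.
From mathcomp Require Import all_classical all_reals all_analysis.

Set Implicit Arguments.
Unset Strict Implicit.
Unset Printing Implicit Defensive.

Import Order.TTheory GRing.Theory Num.Theory.
Import numFieldNormedType.Exports.

Local Open Scope classical_set_scope.
Local Open Scope ring_scope.

(* Real and complex spaces are treated uniformly: in the real case the scalar
   field is R itself, in the complex case it is R[i].  Norms in a
   normedModType over K take values in K, so their real parts are used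
   wherever a real number is needed. *)
Record scalars (R : realType) := Scalars {
  scalar_sort :> numFieldType ;
  re : scalar_sort -> R ;
  im : scalar_sort -> R ;
  of_re_im : R -> R -> scalar_sort }.
Arguments re {R s} _.
Arguments im {R s} _.
Arguments of_re_im {R} s _ _.

Inductive scalar_kind := RealScalars | ComplexScalars.

Definition scalars_of (R : realType) (k : scalar_kind) : scalars R :=
  match k with
  | RealScalars =>
      @Scalars R (R : numFieldType) (fun x => x) (fun=> 0) (fun x _ => x)
  | ComplexScalars =>
      @Scalars R (R[i] : numFieldType)
        (@complex.Re R) (@complex.Im R) (@Complex R)
  end.

Section Banach.
Context {R : realType} {K : scalars R}.

Definition modulus (z : K) : R := re `|z|.

Definition vnorm {V : normedModType K} (x : V) : R := re `|x|.

Definition sphere (V : normedModType K) : set V := [set x | vnorm x = 1].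

(* Supremum of |phi| over the unit ball of the domain D normed by N. *)
Definition functional_norm {J : Type} (D : set J) (N : J -> \bar R)
    (phi : J -> K) : \bar R :=
  ereal_sup [set (modulus (phi j))%:E | j in [set j | D j /\ (N j <= 1)%E]].

Definition dual_sphere (V : normedModType K) : set {scalar V} :=
  [set phi : {scalar V} | continuous (phi : V -> K) /\
     functional_norm [set: V] (fun x => (vnorm x)%:E) phi = 1%E].

Definition slice (V : normedModType K) (phi : V -> K) (eps : R) : set V :=
  [set z | vnorm z <= 1 /\ 1 - eps < re (phi z)].

Definition closed_convex_hull (V : normedModType K) (A : set V) : set V :=
  smallest [set C | closed C /\ convex_set C] A.

Definition closed_aconv (V : normedModType K) (A : set V) : set V :=
  closed_convex_hull
    [set y | exists theta : K, exists2 z, A z &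
       modulus theta = 1 /\ y = theta *: z].

Definition dist_to (V : normedModType K) (y : V) (A : set V) : \bar R :=
  ereal_inf [set (vnorm (y - a))%:E | a in A].

Definition lush (V : normedModType K) : Prop :=
  forall x y : V, sphere x -> sphere y -> forall eps : R, 0 < eps ->
  exists2 phi : {scalar V}, dual_sphere phi &
    slice phi eps x /\ (dist_to y (closed_aconv (slice phi eps)) < eps%:E)%E.

Definition separable (V : topologicalType) : Prop :=
  exists2 D : set V, countable D & dense D.

End Banach.

Section FunctionSpaces.
Context {R : realType} {K : scalars R}.

(* Functions on [0, 1] are represented by functions on R, modulo equality
   mu01-almost everywhere: their values outside [0, 1] are irrelevant.
   Measurable means Borel measurable; a Lebesgue measurable function has a
   Borel representative, so the spaces of classes are the same. *)
Local Notation T := (measurableTypeR R).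

Definition I01 : set R := `[0, 1].

Definition mu01 : {measure set T -> \bar R} :=
  mrestr (@lebesgue_measure R) (measurable_itv `[0%R, 1%R] : measurable I01).

Implicit Types f g h : T -> K.

Definition kmeasurable f : Prop :=
  measurable_fun [set: T] (fun t => re (f t)) /\
  measurable_fun [set: T] (fun t => im (f t)).

Definition kintegrable f : Prop :=
  mu01.-integrable [set: T] (fun t => (re (f t))%:E) /\
  mu01.-integrable [set: T] (fun t => (im (f t))%:E).

Definition kintegral f : K :=
  of_re_im K (\int[mu01]_t re (f t))%R (\int[mu01]_t im (f t))%R.

Definition Lpnorm (p : \bar R) f : \bar R :=
  Lnorm mu01 p (fun t => (modulus (f t))%:E).

Definition ae_equal f g : Prop := \forall t \ae mu01, f t = g t.

Definition simple_function f : Prop := kmeasurable f /\ finite_set (range f).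

Definition linear_span (G : set (T -> K)) : set (T -> K) :=
  [set f | exists n (c : 'I_n -> K) (s : 'I_n -> T -> K),
     (forall i, G (s i)) /\ forall t, f t = \sum_(i < n) c i * s i t].

(* Köthe dual of the function space formed by the F j, j in D, where F j has
   norm N j. *)
Definition dual_of {J : Type} (D : set J) (F : J -> T -> K) : set (T -> K) :=
  [set g | kmeasurable g /\
     forall j, D j -> kintegrable (fun t => F j t * g t)].

Definition dual_of_norm {J : Type} (D : set J) (F : J -> T -> K)
    (N : J -> \bar R) (g : T -> K) : \bar R :=
  functional_norm D N (fun j => kintegral (fun t => F j t * g t)).

(* sigma is the inverse of tau on [0, 1]. *)
Definition measure_preserving_bijection (tau sigma : T -> T) : Prop :=
  [/\ measurable_fun [set: T] tau, measurable_fun [set: T] sigma,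
      set_bij I01 I01 tau, {in I01, cancel tau sigma} &
      forall A, measurable A -> mu01 (tau @^-1` A) = mu01 A].

Section Spaces.
Context {X : completeNormedModType K} (fn : X -> T -> K).

(* The space of classes X is presented by a choice fn x of a representative of
   each class x. *)
Definition represents (x : X) f : Prop := ae_equal (fn x) f.

Definition funs : set (T -> K) :=
  [set f | kmeasurable f /\ exists x, represents x f].

Definition kothe_dual : set (T -> K) := dual_of [set: X] fn.
Definition kothe_dual_norm : (T -> K) -> \bar R :=
  dual_of_norm [set: X] fn (fun x => (vnorm x)%:E).
Definition kothe_bidual : set (T -> K) := dual_of kothe_dual id.
Definition kothe_bidual_norm : (T -> K) -> \bar R :=
  dual_of_norm kothe_dual id kothe_dual_norm.

Record kothe_space : Prop := {
  kothe_integrable : forall x, kintegrable (fn x) ;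
  kothe_linear : forall (a : K) x y,
    represents (a *: x + y) (fun t => a * fn x t + fn y t) ;
  kothe_inj : forall x y, ae_equal (fn x) (fn y) -> x = y ;
  kothe_ideal : forall f x, kmeasurable f ->
    (\forall t \ae mu01, modulus (f t) <= modulus (fn x t)) ->
    exists2 y, represents y f & vnorm y <= vnorm x ;
  kothe_indic : forall A : set T, measurable A ->
    funs (fun t => if t \in A then 1 else 0) }.

Record ri_space : Prop := {
  ri_kothe : kothe_space ;
  ri_invariant : forall tau sigma, measure_preserving_bijection tau sigma ->
    forall f, kintegrable f ->
      (funs f <-> funs (f \o sigma)) /\
      (forall x y, represents x f -> represents y (f \o sigma) ->
         vnorm x = vnorm y) ;
  ri_norming : forall x : X,
    (vnorm x)%:E =
    functional_norm kothe_dual kothe_dual_norm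
      (fun g => kintegral (fun t => fn x t * g t)) ;
  ri_bidual :
    funs = kothe_bidual \/
    funs = [set h | kothe_bidual h /\ forall eps : R, 0 < eps ->
              exists2 s,
                linear_span [set u | [/\ simple_function u, kintegrable u &
                                         kothe_bidual u]] s &
                (kothe_bidual_norm (fun t => h t - s t)%R < eps%:E)%E] ;
  ri_Loo : forall f, kmeasurable f -> (Lpnorm +oo f < +oo)%E ->
    exists2 x, represents x f & ((vnorm x)%:E <= Lpnorm +oo f)%E ;
  ri_L1 : forall x : X, kintegrable (fn x) /\ (Lpnorm 1 (fn x) <= (vnorm x)%:E)%E }.

Definition equals_L1 : Prop :=
  funs = [set f | kintegrable f] /\
  forall x : X, (vnorm x)%:E = Lpnorm 1 (fn x).

End Spaces.
End FunctionSpaces.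

(* Main.v *)
Require Import Defs.
From HB Require Import structures.
From mathcomp Require Import all_boot all_order all_algebra.
From mathcomp Require Import complex ring lra.
From mathcomp Require Import all_classical all_reals all_analysis.
From mathcomp Require Import measurable_realfun ess_sup_inf.

(** Since the L_1 norm is always dominated by the norm of X, it is enough to
    bound the norm of X from above, and only on indicators: from
    ||1_A|| <= mu(A) for all A the bound passes to bounded functions
    ([rho_le_integral01]) and, X being complete, to all integrable ones
    ([integrable_cone]).

    Suppose that ||1_A|| > mu(A).  Lushness at x, y gives a functional phi that
    almost norms x and whose slice almost contains y in its absolutely convex
    hull.  Moduli remove all signs and phases: replace phi by its lattice
    modulus N, a positive functional with N <= ||.||, and each z in the slice by
    |z|; averaging yields w >= y with ||w|| <= 1 + eps and N w > 1 - eps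
    ([lush_function_space]).  Use this for
         x = 1_A / ||1_A|| + kappa 1_G,    y = 1_D / ||1_D||,
    where D is a very small part of the complement of A, G the rest of that
    complement, and kappa > 0 is small.  Think of N as integration against a
    density.  As N(1_A) is about ||1_A|| > mu(A) while N(1) <= 1, the density is
    definitely larger than 1 on a part B of A and at most about 1 on a large
    part of G.  Exchanging the values of a function between two sets preserves
    its norm, hence can hardly increase N at x or at w, which N almost norms.
    For x this shows that the density is not much larger than 1 on most of D,
    because x vanishes on D and is kappa on G ([two_level_gap]).  For w, which is
    at least 1 / ||1_D|| on D, it shows that w >= 1 / (2 ||1_D||) on most of B,
    where the density is larger ([spike_spread]).  But the integral of w is at
    most ||w|| <= 2, which is impossible once ||1_D|| is small compared with
    mu(B).

    Separability enters in the form ||1_E|| -> 0 as mu(E) -> 0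
    ([separable_abs_cont]): it makes ||1_D|| small, and it bounds mu(B) below
    independently of eps.  The exchanges are made by translations only: by
    Fubini, some translate of P meets Q in a set of measure at least
    mu(P) mu(Q) / 3 ([translation_overlap]). *)

Set Implicit Arguments.
Unset Strict Implicit.
Unset Printing Implicit Defensive.

Import Order.TTheory GRing.Theory Num.Theory.
Import numFieldNormedType.Exports.

Local Open Scope classical_set_scope.
Local Open Scope ring_scope.

(** * Translations and exchanges on the unit interval *)

Section Translations.
Context {R : realType}.
Local Notation T := (measurableTypeR R).
Local Notation lambda := (@lebesgue_measure R).
Implicit Types (A P Q : set T) (c : R).

Lemma measurable_addr (c : R) : measurable_fun [set: T] (fun x : T => (x + c : T)).
Proof. exact: measurable_funD. Qed.

Definition measurable_addr_mfun c : {mfun T >-> T} :=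
  HB.pack (fun x : T => (x + c : T)) (isMeasurableFun.Build _ _ _ _ _ (measurable_addr c)).

Lemma lebesgue_measure_translate c A : measurable A ->
  lambda [set x | A (x + c)] = lambda A.
Proof.
move=> mA.
rewrite -[LHS]/(pushforward lambda (measurable_addr_mfun c) A).
apply/esym; apply: lebesgue_measure_unique mA => _ [[a b] _ <-].
rewrite /= /pushforward/=.
have -> : (fun x : R => x + c) @^-1` `]a, b] = `](a - c)%R, (b - c)%R]%classic.
  by apply/seteqP; split => x /=; rewrite !in_itv/= ltrBlDr lerBrDr.
by rewrite !lebesgue_measure_itv/= !lte_fin ltrD2r -!EFinD; congr (if _ then _%:E else _); ring.
Qed.

Lemma mu01E A : A `<=` I01 -> mu01 A = lambda A.
Proof. by move=> AI; rewrite /mu01/= /mrestr setIidl. Qed.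

(** The measures of the sets P `&` (Q - c), integrated over c, give
    mu(P) mu(Q), and only the translations c in [-1, 1] contribute; so one of
    them reaches half of that product.  The weaker constant 3 avoids a strict
    inequality. *)
Lemma translation_overlap P Q : measurable P -> measurable Q ->
  P `<=` I01 -> Q `<=` I01 ->
  exists c, (mu01 P * mu01 Q <= 3%:E * mu01 [set s | P s /\ Q (s + c)%R])%E.
Proof.
move=> mP mQ PI QI.
pose S : set (T * T) := [set z | P z.1 /\ Q (z.1 + z.2)].
have mS : measurable S.
  apply: measurableI.
    by rewrite -[X in measurable X]setTI; apply: measurable_fst.
  rewrite -[X in measurable X]setTI.
  have : measurable_fun setT (fun z : T * T => z.1 + z.2 : T).
    exact: measurable_funD.
  exact.
have secE c : ysection S c = [set s | P s /\ Q (s + c)].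
  by rewrite /ysection; apply/seteqP; split => s /=; rewrite inE.
have prodS : (lambda P * lambda Q)%E = (\int[lambda]_c lambda (ysection S c))%E.
  have <- : (product_measure1 lambda lambda S = \int[lambda]_c lambda (ysection S c))%E.
    rewrite -[RHS]/(product_measure2 lambda lambda S).
    apply: (@product_measure_unique _ _ _ _ _ lambda lambda) => // A B mA mB.
    exact: product_measure2E.
  rewrite /product_measure1.
  have E (s : T) : (lambda \o xsection S) s = ((\1_P s)%:E * lambda Q)%E.
    have [Ps|nPs] := pselect (P s).
      rewrite indicE mem_set// mul1e -(lebesgue_measure_translate s mQ) /=.
      congr (lambda _); apply/seteqP; split => c; rewrite /xsection/= inE/=.
        by rewrite addrC; case.
      by rewrite addrC.
    rewrite indicE memNset// mul0e /= (_ : xsection S s = set0) ?measure0//.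
    by apply/seteqP; split => c; rewrite /xsection/= inE/= => -[].
  rewrite (eq_integral _ _ (fun s _ => E s)).
  rewrite ge0_integralZr ?integral_indic ?setIT//.
  exact: measurableT_comp.
rewrite !mu01E//.
pose c0 := (lambda P * lambda Q)%E.
rewrite -/c0.
apply/not_existsP => H.
have lt1 A : A `<=` I01 -> measurable A -> (lambda A <= 1)%E.
  move=> AI mA; apply: (@le_trans _ _ (lambda `[0%R, 1%R]%classic)).
    by apply: le_measure => //; rewrite inE.
  by rewrite lebesgue_measure_itv/= lte_fin ltr01 oppr0 adde0.
have fP : lambda P \is a fin_num by rewrite ge0_fin_numE// (le_lt_trans (lt1 _ PI mP))// ltey.
have fQ : lambda Q \is a fin_num by rewrite ge0_fin_numE// (le_lt_trans (lt1 _ QI mQ))// ltey.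
have [p pE] : exists p, c0 = p%:E by exists (fine c0); rewrite fineK// fin_numM.
have bnd c : (lambda (ysection S c) <= (p / 3)%:E * (\1_(`[-1, 1]%classic : set T) c)%:E)%E.
  have [c1|c1] := pselect (`[-1, 1]%classic c).
    rewrite indicE mem_set// mule1.
    have := H c; rewrite -secE => /negP; rewrite -ltNge mu01E; last first.
      by move=> s; rewrite secE => -[/PI].
    rewrite pE => /ltW h.
    by rewrite mulrC EFinM lee_pdivlMl.
  rewrite indicE memNset// mule0 secE.
  rewrite (_ : [set s | _] = set0) ?measure0//.
  apply/seteqP; split => s //= -[/PI + /QI].
  rewrite /I01/= !in_itv/= => /andP[s0 s1] /andP[t0 t1].
  by apply: c1; rewrite /= in_itv/=; apply/andP; split; lra.
have p0 : 0 <= p by rewrite -lee_fin -pE mule_ge0.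
have : (p%:E <= (p / 3)%:E * 2%:E)%E.
  rewrite -pE /c0 prodS.
  apply: (@le_trans _ _ (\int[lambda]_c ((p / 3)%:E * (\1_(`[-1, 1]%classic : set T) c)%:E))%E).
    apply: ge0_le_integral => //; first exact: measurable_fun_ysection.
    by apply: emeasurable_funM => //; apply/measurable_EFinP; exact: measurable_indic.
  rewrite ge0_integralZl//; [|exact/measurable_EFinP/measurable_indic|by rewrite lee_fin divr_ge0].
  suff -> : (\int[lambda]_c (\1_(`[-1, 1]%classic : set T) c)%:E)%E = 2%:E by [].
  rewrite integral_indic// setIT.
  transitivity (lambda (`[(-1)%R, 1%R]%classic : set R)) => //.
  rewrite lebesgue_measure_itv/= lte_fin ifT; last by lra.
  by rewrite -EFinB; congr _%:E; ring.
rewrite -EFinM lee_fin => p2.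
have pz : p = 0 by lra.
have := H 0; rewrite pE pz; apply; rewrite mule_ge0//.
Qed.

End Translations.

Section Exchange.
Context {R : realType}.
Local Notation T := (measurableTypeR R).
Local Notation lambda := (@lebesgue_measure R).
Implicit Types (A P Q : set T) (c : R).

(** The involution that swaps P with its translate P + c, assumed disjoint
    from P, and fixes all other points. *)
Definition exchange P c (s : T) : T :=
  if s \in P then s + c else if s - c \in P then s - c else s.

Variables (P : set T) (c : R).
Hypotheses (mP : measurable P) (PI : P `<=` I01)
  (PcI : forall s, P s -> I01 (s + c)) (PcP : forall s, P s -> ~ P (s - c)).

Local Notation tau := (exchange P c).

Lemma exchange_on s : P s -> tau s = s + c.
Proof. by move=> Ps; rewrite /exchange mem_set. Qed.

Lemma exchange_translate s : P (s - c) -> tau s = s - c.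
Proof.
move=> Ps; rewrite /exchange memNset ?mem_set//.
by move=> /PcP.
Qed.

Lemma exchange_off s : ~ P s -> ~ P (s - c) -> tau s = s.
Proof. by move=> Ps Pcs; rewrite /exchange !memNset. Qed.

Lemma exchangeK : involutive tau.
Proof.
move=> s; have [Ps|Ps] := pselect (P s).
  by rewrite (exchange_on Ps) exchange_translate addrK.
have [Pcs|Pcs] := pselect (P (s - c)).
  by rewrite (exchange_translate Pcs) exchange_on// subrK.
by rewrite (exchange_off Ps Pcs) exchange_off.
Qed.

Lemma measurable_subr_preimage (A : set T) : measurable A ->
  measurable [set s : T | A (s - c)].
Proof.
by move=> mA; rewrite -[X in measurable X]setTI; exact: measurable_addr.
Qed.

Lemma measurable_exchange : measurable_fun setT tau.
Proof.
have mb (A : set T) : measurable A -> measurable_fun setT (fun s : T => s \in A).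
  move=> mA; apply: (measurable_fun_bool true).
  rewrite setTI (_ : _ @^-1` _ = A)//.
  by apply/seteqP; split => s /=; [move/set_mem|move/mem_set].
apply: measurable_fun_ifT; [exact: mb|exact: measurable_addr|].
apply: measurable_fun_ifT; [|exact: measurable_addr|exact: measurable_id].
rewrite (_ : (fun s => _) = (fun s : T => s \in [set s : T | P (s - c)])).
  exact: (mb _ (measurable_subr_preimage mP)).
by apply/funext => s; apply/idP/idP => [/set_mem|] h; [apply/mem_set|apply/mem_set; exact: set_mem h].
Qed.

Lemma exchange_I01 s : I01 s -> I01 (tau s).
Proof.
have [Ps|Ps] := pselect (P s); first by rewrite exchange_on// => _; exact: PcI.
have [Pcs|Pcs] := pselect (P (s - c)).
  by rewrite exchange_translate// => _; exact: PI.
by rewrite exchange_off.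
Qed.

Lemma mu01_exchange A : measurable A -> mu01 (tau @^-1` A) = mu01 A.
Proof.
move=> mA.
set Q := [set s : T | P (s - c)].
have mQ : measurable Q by exact: measurable_subr_preimage.
have mQ' A' : measurable A' -> measurable [set s : T | A' (s - c)] by exact: measurable_subr_preimage.
have mD A' : measurable A' -> measurable [set s : T | A' (s + c)].
  by move=> mA'; rewrite -[X in measurable X]setTI; exact: measurable_addr.
have PQ s : P s -> Q s -> False by move=> /PcP.
have QI : Q `<=` I01 by move=> s /PcI; rewrite subrK.
have split3 (B : set T) : measurable B -> mu01 B = (mu01 (B `&` P) + (mu01 (B `&` Q) + mu01 (B `\` (P `|` Q))))%E.
  move=> mB.
  have mBP : measurable (B `&` P) by exact: measurableI.
  have mBQ : measurable (B `&` Q) by exact: measurableI.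
  have mBr : measurable (B `\` (P `|` Q)).
    by apply: measurableD => //; exact: measurableU.
  rewrite -[X in (_ + X)%E]measureU//; last first.
    by apply/seteqP; split => s // [[_ ?] [_ /not_orP[]]].
  rewrite -measureU//; last 2 first.
  - exact: measurableU.
  - by apply/seteqP; split => s // [[_ Ps] [[_ /(PQ _ Ps)]|[_ /not_orP[]]]].
  by rewrite setUA -setIUr setUIDK.
have mtau : measurable (tau @^-1` A).
  by rewrite -[X in measurable X]setTI; exact: measurable_exchange.
rewrite [LHS]split3// [RHS]split3// [LHS]addeCA; congr (_ + (_ + _))%E.
- rewrite !mu01E; [|by move=> s [_ /PI]|by move=> s [_ /QI]].
  rewrite -[RHS](lebesgue_measure_translate (- c)); last exact: measurableI.
  congr (lambda _); apply/seteqP; split => s /= [As Qs]; split => //.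
    by rewrite /= exchange_translate in As.
  by rewrite exchange_translate.
- rewrite !mu01E; [|by move=> s [_ /QI]|by move=> s [_ /PI]].
  rewrite -[RHS](lebesgue_measure_translate c); last exact: measurableI.
  congr (lambda _); apply/seteqP; split => s /= [As Qs]; split => //.
  + by rewrite /= exchange_on in As.
  + by rewrite /Q/= addrK.
  + by rewrite /Q/= addrK in Qs; rewrite exchange_on.
  + by rewrite /Q/= addrK in Qs.
- congr (mu01 _); apply/seteqP; split => s /= [As /[dup] nPQ /not_orP[nP nQ]]; split => //.
    by rewrite exchange_off in As.
  by rewrite exchange_off.
Qed.

Lemma exchange_mpb : measure_preserving_bijection tau tau.
Proof.
split; [exact: measurable_exchange|exact: measurable_exchange|split| |exact: mu01_exchange].
- exact: exchange_I01.
- by move=> s t _ _; exact/can_inj/exchangeK.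
- by move=> s Is; exists (tau s); [exact: exchange_I01|exact: exchangeK].
- by move=> s _; exact: exchangeK.
Qed.

End Exchange.

Section Integrals.
Context {R : realType}.
Local Notation T := (measurableTypeR R).
Implicit Types (A B : set T) (f g : T -> R).

(** Real-valued, so that the estimates below are linear arithmetic. *)
Definition meas A : R := fine (mu01 A).

Lemma mu01_setT : mu01 [set: T] = 1%E.
Proof.
rewrite /mu01/= /mrestr setTI.
transitivity (lebesgue_measure (`[0, 1]%classic : set R)) => //.
by rewrite lebesgue_measure_itv/= lte_fin ltr01 oppr0 adde0.
Qed.

Lemma mu01_le1 A : measurable A -> (mu01 A <= 1)%E.
Proof. by move=> mA; rewrite -mu01_setT; apply: le_measure => //; rewrite inE. Qed.

Lemma mu01_fin A : measurable A -> mu01 A \is a fin_num.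
Proof.
by move=> mA; rewrite ge0_fin_numE// (le_lt_trans (mu01_le1 mA))// ltey.
Qed.

Lemma measE A : measurable A -> (meas A)%:E = mu01 A.
Proof. by move=> mA; rewrite fineK// mu01_fin. Qed.

Lemma meas_ge0 A : 0 <= meas A. Proof. exact: fine_ge0. Qed.

Lemma meas_setT : meas setT = 1. Proof. by rewrite /meas mu01_setT. Qed.

Lemma meas_le A B : measurable A -> measurable B -> A `<=` B -> meas A <= meas B.
Proof.
by move=> mA mB AB; rewrite -lee_fin !measE//; apply: le_measure; rewrite ?inE.
Qed.

Lemma meas_setD A B : measurable A -> measurable B ->
  meas A = meas (A `&` B) + meas (A `\` B).
Proof.
move=> mA mB; apply: EFin_inj; rewrite EFinD !measE//; last 2 first.
- exact: measurableD.
- exact: measurableI.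
rewrite -measureU.
- by rewrite setUIDK.
- exact: measurableI.
- exact: measurableD.
- by apply/seteqP; split => s // [[_ ?] []].
Qed.

Lemma meas_I01 A : measurable A -> meas (A `&` I01) = meas A.
Proof.
by move=> mA; rewrite /meas /mu01/= /mrestr -setIA setIid.
Qed.

Local Notation intble f := (mu01.-integrable [set: T] (EFin \o f)).

Lemma bounded_integrable f (M : R) : measurable_fun setT f ->
  (forall t, `|f t| <= M) -> intble f.
Proof.
move=> mf fM; apply: measurable_bounded_integrable => //.
  by rewrite mu01_setT ltey.
exists M; split; first exact: num_real.
by move=> x Mx t _; exact: le_trans (fM t) (ltW Mx).
Qed.

Lemma Rintegral_indic A : measurable A -> \int[mu01]_t (\1_A t) = meas A.
Proof. by move=> mA; rewrite /Rintegral integral_indic// setIT. Qed.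

Lemma integrable_mu01_indic A : measurable A -> intble (\1_A : T -> R).
Proof.
move=> mA; apply: (@bounded_integrable _ 1); first exact: measurable_indic.
by move=> t; rewrite indicE; case: (_ \in _); rewrite ?normr1 ?normr0.
Qed.

Lemma Rintegral_mpb (tau : T -> T) f :
  measurable_fun setT tau -> (forall A, measurable A -> mu01 (tau @^-1` A) = mu01 A) ->
  measurable_fun setT f -> (forall t, 0 <= f t) ->
  \int[mu01]_t f (tau t) = \int[mu01]_t f t.
Proof.
move=> mtau tauE mf f0; rewrite /Rintegral; congr fine.
have mfE : measurable_fun setT (EFin \o f) by exact/measurable_EFinP.
have -> : (\int[mu01]_t (f t)%:E)%E =
  (\int[pushforward mu01 tau]_t (f t)%:E)%E.
  apply: eq_measure_integral => A mA _; exact/esym/tauE.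
by rewrite ge0_integral_pushforward// => t _; rewrite lee_fin.
Qed.

End Integrals.

(** * Positive functionals on a symmetric cone *)

Section Cone.
Context {R : realType}.
Local Notation T := (measurableTypeR R).
Implicit Types (A P Q : set T) (f g u w : T -> R) (N : (T -> R) -> R).
Local Notation intble f := (mu01.-integrable [set: T] (EFin \o f)).

(** What is retained of X: the cone E of its non-negative functions and their
    norms.  The last field is the continuity of the norm at the empty set that
    separability provides. *)
Record symmetric_norm (E : set (T -> R)) (rho : (T -> R) -> R) : Prop := {
  sn_measurable : forall f, E f -> measurable_fun setT f ;
  sn_ge0 : forall f, E f -> forall t, 0 <= f t ;
  sn_solid : forall f g, E g -> measurable_fun setT f ->
    (forall t, 0 <= f t <= g t) -> E f /\ rho f <= rho g ;
  sn_add : forall f g, E f -> E g -> E (f \+ g) /\ rho (f \+ g) <= rho f + rho g ;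
  sn_scale : forall (c : R) f, 0 <= c -> E f ->
    E (fun t => c * f t) /\ rho (fun t => c * f t) = c * rho f ;
  sn_one : E (cst 1) /\ rho (cst 1) <= 1 ;
  sn_L1 : forall f, E f -> intble f /\ \int[mu01]_t f t <= rho f ;
  sn_symmetric : forall tau, measure_preserving_bijection tau tau ->
    forall f, E f -> E (f \o tau) /\ rho (f \o tau) = rho f ;
  sn_abs_cont : forall c : R, 0 < c -> exists2 s : R, 0 < s &
    forall A, measurable A -> meas A < s -> rho (\1_A) < c }.

(** On the cone E these are the positive functionals of norm at most one. *)
Record dominated (E : set (T -> R)) (rho N : (T -> R) -> R) : Prop := {
  dom_add : forall f g, E f -> E g -> N (f \+ g) = N f + N g ;
  dom_scale : forall (c : R) f, 0 <= c -> E f -> N (fun t => c * f t) = c * N f ;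
  dom_ge0 : forall f, E f -> 0 <= N f ;
  dom_le : forall f, E f -> N f <= rho f }.

(** Lushness after all functions have been replaced by their moduli. *)
Definition lush_cone (E : set (T -> R)) (rho : (T -> R) -> R) : Prop :=
  forall u y (eps : R), E u -> E y -> rho u = 1 -> rho y = 1 -> 0 < eps ->
  exists N w, [/\ dominated E rho N, 1 - eps < N u, E w,
    forall t, y t <= w t & rho w <= 1 + eps /\ 1 - eps < N w].

(** The density of N is at most a on P, up to the total error eta; similarly
    for [above].  Stated with functions rather than subsets of P, it applies
    directly to the increments created by an exchange. *)
Definition below N (a eta : R) P : Prop := forall f, measurable_fun setT f ->
  (forall t, 0 <= f t <= \1_P t) -> N f <= a * \int[mu01]_t f t + eta.

Definition above N (a eta : R) P : Prop := forall f, measurable_fun setT f ->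
  (forall t, 0 <= f t <= \1_P t) -> a * \int[mu01]_t f t - eta <= N f.

Lemma measurable_sublevel f (c : R) : measurable_fun setT f ->
  measurable [set t | f t <= c].
Proof.
move=> mf; rewrite -[X in measurable X]setTI.
rewrite (_ : [set t | f t <= c] = f @^-1` `]-oo, c]); last first.
  by apply/seteqP; split => t /=; rewrite in_itv.
by apply: mf => //; exact: measurable_itv.
Qed.

Lemma le_indic A B (t : T) : A `<=` B -> (\1_A t : R) <= \1_B t.
Proof.
move=> AB; rewrite !indicE; have [/set_mem/AB/mem_set ->//|_] := boolP (t \in A).
by case: (_ \in _).
Qed.

Lemma belowS N a eta P Q : Q `<=` P -> below N a eta P -> below N a eta Q.
Proof.
move=> QP NP f mf fQ; apply: NP => // t; have /andP[-> /le_trans ->//] := fQ t.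
exact: le_indic.
Qed.

Lemma aboveS N a eta P Q : Q `<=` P -> above N a eta P -> above N a eta Q.
Proof.
move=> QP NP f mf fQ; apply: NP => // t; have /andP[-> /le_trans ->//] := fQ t.
exact: le_indic.
Qed.

Variables (E : set (T -> R)) (rho : (T -> R) -> R).
Hypothesis snE : symmetric_norm E rho.

Lemma E_bounded (M : R) f : measurable_fun setT f -> (forall t, 0 <= f t <= M) -> E f.
Proof.
move=> mf f01; have M0 : 0 <= M by have /andP[h1 h2] := f01 0; exact: le_trans h2.
have [EM _] := sn_scale snE M0 (sn_one snE).1.
apply: (sn_solid snE EM mf _).1 => t /=; by rewrite mulr1.
Qed.

Lemma indic01 A (t : T) : 0 <= (\1_A t : R) <= 1.
Proof. by rewrite indicE; case: (_ \in _); rewrite ?lexx ler01. Qed.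

Lemma E_indic A : measurable A -> E (\1_A).
Proof. by move=> mA; apply: (E_bounded (measurable_indic _)) => //; exact: indic01. Qed.

Lemma meas_le_rho A : measurable A -> meas A <= rho (\1_A).
Proof. by move=> mA; rewrite -Rintegral_indic//; apply: (sn_L1 snE (E_indic mA)).2. Qed.

(** An approximate Hahn decomposition for N - a mu.  Let f0 almost maximize
    N f - a int f over 0 <= f <= 1.  Where f0 <= 1/2 one may add f/2 to f0, and
    elsewhere subtract f/2 from it, so that N - a int is almost nonpositive on the
    first set and almost nonnegative on the second. *)
Lemma dominated_split N (a eta : R) : dominated E rho N -> 0 <= a -> 0 < eta ->
  exists H, [/\ measurable H, below N a eta H & above N a eta (~` H)].
Proof.
move=> dN a0 eta0.
pose F := [set f : T -> R | measurable_fun setT f /\ forall t, 0 <= f t <= 1].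
have EF f : F f -> E f by move=> [mf]; exact: E_bounded.
pose L f := N f - a * \int[mu01]_t f t.
have supF : has_sup (L @` F).
  split; first by exists (L (cst 0)), (cst 0) => //; split => // t; rewrite lexx ler01.
  exists 1 => _ [f Ff <-]; rewrite /L lerBlDr.
  apply: (@le_trans _ _ 1); last first.
    by rewrite lerDl mulr_ge0// Rintegral_ge0// => t _; case: Ff => _ /(_ t)/andP[].
  apply: (le_trans (dom_le dN (EF _ Ff))); apply: le_trans (sn_one snE).2.
  exact: (sn_solid snE (sn_one snE).1 Ff.1 Ff.2).2.
have eta2 : 0 < eta / 2 by rewrite divr_gt0.
have [_ [f0 [mf0 f01] <-] Lf0] := sup_adherent eta2 supF.
have supub f : F f -> L f <= sup (L @` F) by move=> Ff; apply: ub_le_sup; [case: supF|exists f].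
have mH : measurable [set t | f0 t <= 1 / 2].
  exact: measurable_sublevel.
have half f : F f -> F (fun t => 1 / 2 * f t).
  move=> [mf f1]; split; first exact: measurable_funM.
  by move=> t; have := f1 t; lra.
have halfN f : F f -> N (fun t => 1 / 2 * f t) = 1 / 2 * N f.
  by move=> Ff; rewrite (dom_scale dN) ?divr_ge0//; exact: EF.
have intF f : F f -> intble f.
  by move=> /EF Ef; have [] := sn_L1 snE Ef.
have halfI f : F f -> \int[mu01]_t (1 / 2 * f t) = 1 / 2 * \int[mu01]_t f t.
  by move=> Ff; rewrite RintegralZl//; exact: intF.
exists [set t | f0 t <= 1 / 2]; split => //.
- move=> f mf fH.
  have Ff : F f by split => // t; have := fH t; have := indic01 [set t | f0 t <= 1 / 2] t; lra.
  have Fs : F (f0 \+ (fun t => 1 / 2 * f t)).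
    split => [|t /=]; first by apply: measurable_funD => //; exact: (half _ Ff).1.
    have := fH t; have := f01 t; rewrite indicE; case: (boolP (t \in _)) => [/set_mem/=|_ /=]; lra.
  have := supub _ Fs; rewrite {1}/L (dom_add dN (EF _ (conj mf0 f01)) (EF _ (half _ Ff))).
  rewrite RintegralD//; [|exact: intF|exact: (intF _ (half _ Ff))].
  rewrite halfN// halfI//; move: Lf0; rewrite /L; lra.
- move=> f mf fH.
  have Ff : F f by split => // t; have := fH t; have := indic01 (~` [set t | f0 t <= 1 / 2]) t; lra.
  have hf0 t : 1 / 2 * f t <= f0 t.
    have := fH t; have := f01 t; rewrite indicE; case: (boolP (t \in _)) => [/set_mem/= /negP|_ /=]; rewrite -?ltNge; lra.
  have Fs : F (f0 \- (fun t => 1 / 2 * f t)).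
    split => [|t /=]; first by apply: measurable_funB => //; exact: (half _ Ff).1.
    have := hf0 t; have := f01 t; have := fH t; lra.
  have := supub _ Fs.
  have -> : L (f0 \- (fun t => 1 / 2 * f t)) = L f0 - 1 / 2 * L f.
    have f0E : f0 = (f0 \- (fun t => 1 / 2 * f t)) \+ (fun t => 1 / 2 * f t).
      by apply/funext => t /=; rewrite subrK.
    rewrite {2}/L [in N f0]f0E (dom_add dN (EF _ Fs) (EF _ (half _ Ff))).
    rewrite /L halfN// RintegralB//; [|exact: intF|exact: (intF _ (half _ Ff))].
    by rewrite halfI//; ring.
  move: Lf0; rewrite /L; lra.
Qed.

(** If the values of u are larger on P than on Q while the density of N is
    larger on Q than on P, then moving u from a part P0 of P to its translate in
    Q increases N u by at least (b - a)(p - q) mu(P0); the result has the same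
    norm as u and so bounds this gain by rho u - N u.  The bound M on P
    controls the error of [below] and [above], which hold for functions between
    0 and 1. *)
Lemma exchange_gain N u P Q (p q M a b eta : R) :
  dominated E rho N -> E u ->
  measurable P -> measurable Q -> P `<=` I01 -> Q `<=` I01 ->
  (forall s, P s -> ~ Q s) -> q <= p -> 0 < M -> a <= b ->
  (forall s, P s -> p <= u s <= M) -> (forall s, Q s -> u s <= q) ->
  below N a eta P -> above N b eta Q ->
  N u + (b - a) * (p - q) * (meas P * meas Q / 3) <= rho u + 2 * eta * M.
Proof.
move=> dN Eu mP mQ PI QI PQ qp M0 ab uP uQ NP NQ.
have [c cPQ] := translation_overlap mP mQ PI QI.
set P0 := [set s : T | P s /\ Q (s + c)%R] in cPQ.
have mP0 : measurable P0.
  apply: (measurableI P [set s : T | Q (s + c)]) => //.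
  by rewrite -[X in measurable X]setTI; apply: measurable_addr.
have {}cPQ : meas P * meas Q / 3 <= meas P0.
  by rewrite ler_pdivrMr// [leRHS]mulrC -lee_fin !EFinM !measE.
have P0I : P0 `<=` I01 by move=> s [/PI].
have P0cI s : P0 s -> I01 (s + c) by move=> [_ /QI].
have P0cP s : P0 s -> ~ P0 (s - c) by move=> [/PQ nQ _] [_]; rewrite subrK.
pose tau := exchange P0 c.
have tauB : measure_preserving_bijection tau tau by exact: exchange_mpb.
have mtau : measurable_fun setT tau by case: tauB.
have mu : measurable_fun setT u by exact: (sn_measurable snE Eu).
have [Eut rhout] := sn_symmetric snE tauB Eu.
pose h t := (u t - u (tau t)) * \1_P0 t.
have mh : measurable_fun setT h.
  apply: measurable_funM; last exact: measurable_indic.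
  by apply: measurable_funB => //; exact: measurableT_comp.
have u0 t : 0 <= u t by exact: (sn_ge0 snE Eu).
have hP0 s : P0 s -> (h s = u s - u (s + c)) /\ p - q <= h s <= M.
  move=> Ps; have hE : h s = u s - u (s + c).
    by rewrite /h /tau exchange_on// indicE mem_set// mulr1.
  split => //; rewrite hE; case: Ps => /uP us /uQ; have := u0 (s + c); lra.
have h0 s : ~ P0 s -> h s = 0 by move=> Ps; rewrite /h indicE memNset// mulr0.
have hM t : 0 <= h t / M <= \1_P0 t.
  have [Pt|Pt] := pselect (P0 t); last by rewrite h0// mul0r indicE memNset// lexx.
  have [_ /andP[h1 h2]] := hP0 _ Pt; rewrite indicE mem_set//.
  apply/andP; split; last by rewrite /= ler_pdivrMr// mul1r.
  by apply: divr_ge0; [apply: le_trans h1; rewrite subr_ge0|exact: ltW].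
have hb t : 0 <= h t <= M.
  have /andP[h1 h2] := hM t.
  have hE : h t = M * (h t / M) by rewrite mulrC divfK// gt_eqF.
  have /andP[_ h3] := indic01 P0 t.
  by rewrite hE mulr_ge0 ?(ltW M0)//= ler_piMr ?(ltW M0)// (le_trans h2).
have Eh : E h by exact: (E_bounded mh hb).
pose h' := h \o tau.
have mh' : measurable_fun setT h' by exact: measurableT_comp.
have h'b t : 0 <= h' t <= M by exact: hb.
have Eh' : E h' by exact: (E_bounded mh' h'b).
have inth : \int[mu01]_t h' t = \int[mu01]_t h t.
  apply: (@Rintegral_mpb _ tau h) => //; first by case: tauB.
  by move=> t; case/andP: (hb t).
have balance : (u \o tau) \+ h = u \+ h'.
  apply/funext => t /=; rewrite /h'/=.
  have [Pt|Pt] := pselect (P0 t).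
    have [-> _] := hP0 _ Pt; rewrite /tau exchange_on//.
    rewrite [h (t + c)]h0 ?addr0; first by ring.
    by move=> /P0cP; rewrite addrK.
  rewrite (h0 _ Pt) addr0.
  have [Pct|Pct] := pselect (P0 (t - c)).
    rewrite /tau exchange_translate//; have [-> _] := hP0 _ Pct; rewrite subrK; ring.
  by rewrite /tau exchange_off// h0// addr0.
have Nbal : N (u \o tau) + N h = N u + N h'.
  by rewrite -!(dom_add dN)// balance.
have scaleN g : E g -> N g = M * N (fun t => g t / M).
  move=> Eg; have EgM : E (fun t => g t / M).
    have Mi : 0 <= M^-1 by rewrite invr_ge0 ltW.
    have [+ _] := sn_scale snE Mi Eg.
    by congr E; apply/funext => t; rewrite mulrC.
  rewrite -(dom_scale dN) ?ltW//; congr N; apply/funext => t.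
  by rewrite mulrC divfK// gt_eqF.
have intZ g : E g -> \int[mu01]_t (g t / M) = (\int[mu01]_t g t) / M.
  by move=> Eg; rewrite RintegralZr//; have [] := sn_L1 snE Eg.
have mdiv g : measurable_fun setT g -> measurable_fun setT (fun t => g t / M).
  by move=> mg; exact: measurable_funM.
have Nh : N h <= a * (\int[mu01]_t h t) + M * eta.
  rewrite scaleN//.
  have := NP _ (mdiv _ mh); rewrite intZ// => H.
  have {}H : N (fun t => h t / M) <= a * ((\int[mu01]_t h t) / M) + eta.
    apply: H => t; have /andP[-> /le_trans ->//] := hM t.
    by apply: le_indic => s [].
  apply: (le_trans (ler_wpM2l (ltW M0) H)); rewrite mulrDr lerD2r mulrCA.
  by rewrite (mulrC M) divfK// gt_eqF.
have Nh' : b * (\int[mu01]_t h t) - M * eta <= N h'.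
  rewrite [N h']scaleN//.
  have := NQ _ (mdiv _ mh'); rewrite intZ// inth => H.
  have {}H : b * ((\int[mu01]_t h t) / M) - eta <= N (fun t => h' t / M).
    apply: H => t; have /andP[-> h2] /= := hM (tau t).
    apply: (le_trans h2); rewrite !indicE; case: (boolP (tau t \in P0)) => [/set_mem Pt|_].
      rewrite mem_set//; have := exchangeK P0cP t; rewrite -/tau => <-.
      by rewrite {1}/tau exchange_on//; case: Pt.
    by case: (_ \in _).
  apply: (le_trans _ (ler_wpM2l (ltW M0) H)); rewrite mulrBr lerD2r mulrCA.
  by rewrite (mulrC M) divfK// gt_eqF.
have hlow : (p - q) * meas P0 <= \int[mu01]_t h t.
  rewrite -Rintegral_indic// -RintegralZl//; last exact: integrable_mu01_indic.
  apply: le_Rintegral => //.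
  - apply: (@bounded_integrable _ _ `|p - q|).
      by apply: measurable_funM => //; exact: measurable_indic.
    move=> t; rewrite normrM -[leRHS]mulr1 ler_wpM2l//.
    by rewrite indicE; case: (_ \in _); rewrite ?normr1 ?normr0.
  - by have [] := sn_L1 snE Eh.
  - move=> t _; have [Pt|Pt] := pselect (P0 t).
      by rewrite indicE mem_set// mulr1; have [_ /andP[]] := hP0 _ Pt.
    by rewrite indicE memNset// mulr0 h0.
have Nut : N (u \o tau) <= rho u by rewrite -rhout; exact: dom_le dN _ Eut.
have gain : (b - a) * (p - q) * (meas P * meas Q / 3) <= (b - a) * \int[mu01]_t h t.
  rewrite -mulrA ler_wpM2l ?subr_ge0// (le_trans _ hlow)// ler_wpM2l// subr_ge0//.
move: gain; rewrite [X in _ <= X]mulrBl; lra.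
Qed.

End Cone.

(** * Norms of indicators in a lush cone *)

Section LushCone.
Context {R : realType}.
Local Notation T := (measurableTypeR R).
Implicit Types (A P Q : set T) (f g u w : T -> R).

(** Halving the interval that carries A repeatedly, always keeping a half in
    which A has positive measure. *)
Lemma small_subset A (s : R) : measurable A -> 0 < meas A -> 0 < s ->
  exists D, [/\ measurable D, D `<=` A `&` I01, 0 < meas D & meas D < s].
Proof.
move=> mA A0 s0.
have H n : exists a : R, 0 < meas (A `&` I01 `&` `[a, a + 2 ^- n]).
  elim: n => [|n [a an]].
    by exists 0; rewrite expr0 invr1 add0r -setIA setIid meas_I01.
  pose m := a + 2 ^- n.+1.
  have [h|h] := ltP 0 (meas (A `&` I01 `&` `[a, m])); first by exists a.
  exists m; rewrite lt_neqAle meas_ge0 andbT; apply/eqP => h'.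
  have mAI : measurable (A `&` I01) by apply: measurableI => //; exact: measurable_itv.
  have mAB (x y : R) : measurable (A `&` I01 `&` `[x, y]).
    by apply: measurableI => //; exact: measurable_itv.
  have := meas_setD (mAB a (a + 2 ^- n)) (measurable_itv `[a, m]).
  have : meas (A `&` I01 `&` `[a, a + 2 ^- n] `&` `[a, m]) <= meas (A `&` I01 `&` `[a, m]).
    by apply: meas_le => //; [apply: measurableI => //; exact: measurable_itv|move=> t [[? _] ?]].
  have : meas (A `&` I01 `&` `[a, a + 2 ^- n] `\` `[a, m]) <= meas (A `&` I01 `&` `[m, m + 2 ^- n.+1]).
    apply: meas_le => //; first by apply: measurableD => //; exact: measurable_itv.
    move=> t [[At]]; rewrite /= !in_itv/= => /andP[at1 at2] /negP; rewrite at1/= -ltNge => mt.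
    split => //=; rewrite (ltW mt)/= (le_trans at2)// /m -addrA lerD2l exprS invfM.
    lra.
  move: an; rewrite -h'; lra.
have [n ns] : exists n, (2 ^- n : R) < s.
  have := @cvg_geometric R 1 2^-1; rewrite ger0_norm ?invr_ge0// invf_lt1// ltr1n.
  move=> /(_ isT)/cvgr_lt/(_ _ s0)[n _ /(_ n (leqnn n))/=].
  by rewrite /geometric/= mul1r exprVn; exists n.
have [a an] := H n; exists (A `&` I01 `&` `[a, a + 2 ^- n]).
have mD : measurable (A `&` I01 `&` `[a, a + 2 ^- n]).
  apply: measurableI; [apply: measurableI => //|]; exact: measurable_itv.
split => //; apply: le_lt_trans ns.
rewrite -lee_fin measE// mu01E; last by move=> t [[]].
apply: (@le_trans _ _ (lebesgue_measure (`[a, a + 2 ^- n]%classic : set R))).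
  by apply: le_measure; rewrite ?inE//; exact: measurable_itv.
rewrite lebesgue_measure_itv/= lte_fin; case: ifP => _; last by rewrite lee_fin invr_ge0 exprn_ge0.
by rewrite -EFinB lee_fin addrAC subrr add0r.
Qed.

Lemma small_enough4 (a b c d : R) : 0 < a -> 0 < b -> 0 < c -> 0 < d ->
  exists e, [/\ 0 < e, e <= a, e <= b, e <= c & e <= d].
Proof.
move=> a0 b0 c0 d0; exists (Num.min (Num.min a b) (Num.min c d)).
by rewrite !lt_min a0 b0 c0 d0 !ge_min !lexx ?orbT.
Qed.

Lemma markov_integral w (M : R) : mu01.-integrable [set: T] (EFin \o w) ->
  (forall t, 0 <= w t) -> 0 < M ->
  meas (~` [set t | w t <= M]) <= (\int[mu01]_t w t) / M.
Proof.
move=> wi w0 M0; rewrite ler_pdivlMr// mulrC.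
have mS : measurable (~` [set t | w t <= M]).
  apply: measurableC; apply: measurable_sublevel.
  by have /measurable_int/measurable_EFinP := wi.
rewrite -Rintegral_indic// -RintegralZl//; last exact: integrable_mu01_indic.
apply: le_Rintegral => //.
- apply: (@bounded_integrable _ _ M).
    by apply: measurable_funM => //; exact: measurable_indic.
  move=> t; have /andP[i0 i1] := indic01 (R := R) (~` [set t | w t <= M]) t.
  by rewrite ger0_norm ?mulr_ge0 ?(ltW M0)// ler_piMr ?(ltW M0).
- move=> t _; rewrite indicE; case: (boolP (t \in _)) => [/set_mem/= /negP|_].
    by rewrite -ltNge mulr1 => /ltW.
  by rewrite mulr0 w0.
Qed.

Variables (E : set (T -> R)) (rho : (T -> R) -> R).
Hypothesis snE : symmetric_norm E rho.

Lemma markov_rho w (M : R) : E w -> 0 < M -> meas (~` [set t | w t <= M]) <= rho w / M.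
Proof.
move=> Ew M0; have [wi wrho] := sn_L1 snE Ew.
apply: (le_trans (markov_integral wi (sn_ge0 snE Ew) M0)).
by rewrite ler_pM2r ?invr_gt0.
Qed.

Lemma indicD A P : (forall t, A t -> ~ P t) ->
  (\1_(A `|` P) : T -> R) = (\1_A : T -> R) \+ \1_P.
Proof.
move=> AP; apply/funext => t /=; rewrite !indicE in_setU.
case: (boolP (t \in A)) => [/set_mem/AP At|_] /=; last by rewrite add0r.
by rewrite memNset// addr0.
Qed.

Lemma dom_setD N A P : dominated E rho N -> measurable A -> measurable P ->
  N (\1_A) = N (\1_(A `&` P)) + N (\1_(A `\` P)).
Proof.
move=> dN mA mP; rewrite -(dom_add dN); last 2 first.
- exact/(E_indic snE)/measurableI.
- exact/(E_indic snE)/measurableD.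
by rewrite -indicD ?setUIDK// => t [_ Pt] [].
Qed.

Lemma below_indic N (a eta : R) P : below N a eta P -> measurable P ->
  N (\1_P) <= a * meas P + eta.
Proof.
move=> NP mP; rewrite -Rintegral_indic//; apply: NP; first exact: measurable_indic.
by move=> t; rewrite lexx; case/andP: (indic01 (R := R) P t) => ->.
Qed.

Lemma above_indic N (a eta : R) P : above N a eta P -> measurable P ->
  a * meas P - eta <= N (\1_P).
Proof.
move=> NP mP; rewrite -Rintegral_indic//; apply: NP; first exact: measurable_indic.
by move=> t; rewrite lexx; case/andP: (indic01 (R := R) P t) => ->.
Qed.

Lemma rho_indic_le1 P : measurable P -> rho (\1_P) <= 1.
Proof.
move=> mP; have [E1 rho1] := sn_one snE; apply: le_trans rho1.
apply: (sn_solid snE E1 _ _).2; first exact: measurable_indic.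
by move=> s; exact: indic01.
Qed.

Lemma dom_indic_le1 N P : dominated E rho N -> measurable P -> N (\1_P) <= 1.
Proof.
move=> dN mP; apply: le_trans (rho_indic_le1 mP).
by apply: (dom_le dN); exact: (E_indic snE).
Qed.

(** On H the functional contributes at most a mu(A) + e, so at least c is left
    for the part outside H, which forces it to have a certain measure. *)
Lemma high_part_meas N (a e s c : R) A H : dominated E rho N -> 0 <= a ->
  measurable A -> measurable H -> below N a e H ->
  (forall B, measurable B -> meas B < s -> rho (\1_B) < c) ->
  a * meas A + e + c <= N (\1_A) -> s <= meas (A `\` H).
Proof.
move=> dN a0 mA mH NH small NA; rewrite leNgt; apply/negP.
have mAD : measurable (A `\` H) by exact: measurableD.
have mAI : measurable (A `&` H) by exact: measurableI.
move=> /(small _ mAD) lt_c.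
have h1 := dom_setD dN mA mH.
have h2 := below_indic (belowS (@subIsetr _ A H) NH) mAI.
have h3 : a * meas (A `&` H) <= a * meas A by rewrite ler_wpM2l ?meas_le.
have h4 := dom_le dN (E_indic snE mAD).
by clear - NA lt_c h1 h2 h3 h4; lra.
Qed.

Lemma low_part_meas N (a e v : R) G H : dominated E rho N ->
  measurable G -> measurable H -> above N a e (~` H) -> N (\1_G) <= v ->
  a * (meas G - meas (G `&` H)) <= v + e.
Proof.
move=> dN mG mH NH NG.
have mGD : measurable (G `\` H) by exact: measurableD.
have h1 := above_indic (aboveS (@subIsetr _ G (~` H)) NH) mGD; rewrite -setDE in h1.
have h2 := dom_setD dN mG mH.
have h3 := dom_ge0 dN (E_indic snE (measurableI _ _ mG mH)).
have -> : meas G - meas (G `&` H) = meas (G `\` H) by rewrite (meas_setD mG mH) addrC addKr.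
by clear - NG h1 h2 h3; lra.
Qed.

(** The function x at which lushness is used: normalized on A, and at the low level
    kap on G in order to rank G above the set D where it vanishes. *)
Definition two_level A G (kap : R) : T -> R :=
  (fun s => (rho (\1_A))^-1 * \1_A s) \+ (fun s => kap * \1_G s).

Lemma two_level_norm A G (kap : R) : measurable A -> measurable G ->
  0 < rho (\1_A) -> 0 <= kap ->
  E (two_level A G kap) /\ 1 <= rho (two_level A G kap) <= 1 + kap.
Proof.
move=> mA mG f0 kap0.
have fV0 : 0 <= (rho (\1_A))^-1 by rewrite invr_ge0 ltW.
have [EA rhoA] := sn_scale snE fV0 (E_indic snE mA).
have [EG rhoG] := sn_scale snE kap0 (E_indic snE mG).
rewrite mulVf ?gt_eqF// in rhoA.
have [Ex rhox] := sn_add snE EA EG; split => //; apply/andP; split.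
  rewrite -rhoA; apply: (sn_solid snE Ex (sn_measurable snE EA) _).2 => s.
  by rewrite (sn_ge0 snE EA)/= lerDl (sn_ge0 snE EG).
by apply: (le_trans rhox); rewrite rhoA rhoG lerD2l ler_piMr// rho_indic_le1.
Qed.

Lemma lush_cone_witness A G D (kap e : R) : lush_cone E rho ->
  measurable A -> measurable G -> measurable D ->
  0 < rho (\1_A) -> 0 < rho (\1_D) -> 0 <= kap -> 0 < e ->
  exists N w, [/\ dominated E rho N,
    (1 - e) * rho (two_level A G kap) < N (two_level A G kap), E w,
    forall s, D s -> (rho (\1_D))^-1 <= w s & rho w <= 1 + e /\ 1 - e < N w].
Proof.
move=> lushE mA mG mD f0 fD0 kap0 e0.
have [Ex /andP[x1 _]] := two_level_norm mA mG f0 kap0.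
have x0 := lt_le_trans ltr01 x1.
have xV0 : 0 <= (rho (two_level A G kap))^-1 by rewrite invr_ge0 ltW.
have [Eu rhou] := sn_scale snE xV0 Ex; rewrite mulVf ?gt_eqF// in rhou.
have fDV0 : 0 <= (rho (\1_D))^-1 by rewrite invr_ge0 ltW.
have [Ey rhoy] := sn_scale snE fDV0 (E_indic snE mD); rewrite mulVf ?gt_eqF// in rhoy.
have [N [w [dN Nu Ew yw rhow]]] := lushE _ _ _ Eu Ey rhou rhoy e0.
exists N, w; split => //.
  by move: Nu; rewrite (dom_scale dN)// mulrC ltr_pdivlMr.
by move=> s Ds; apply: le_trans (yw s); rewrite indicE mem_set// mulr1.
Qed.

Lemma two_level_dom N A G (kap e : R) : dominated E rho N ->
  measurable A -> measurable G -> 0 < rho (\1_A) -> 0 <= kap -> 0 <= e <= 1 ->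
  (1 - e) * rho (two_level A G kap) < N (two_level A G kap) ->
  rho (\1_A) - (e + kap) <= N (\1_A).
Proof.
move=> dN mA mG f0 kap0 /andP[e0 e1].
have fV0 : 0 <= (rho (\1_A))^-1 by rewrite invr_ge0 ltW.
have [Ex /andP[x1 _]] := two_level_norm mA mG f0 kap0.
have EA := E_indic snE mA; have EG := E_indic snE mG.
rewrite (dom_add dN (sn_scale snE fV0 EA).1 (sn_scale snE kap0 EG).1) !(dom_scale dN)//.
have NG : kap * N (\1_G) <= kap by rewrite ler_piMr// dom_indic_le1.
have h1 : 1 - e <= (1 - e) * rho (two_level A G kap) by rewrite ler_peMr// subr_ge0.
move=> h2; have h3 : 1 - (e + kap) <= (rho (\1_A))^-1 * N (\1_A) by clear - NG h1 h2; lra.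
have h4 : rho (\1_A) * (1 - (e + kap)) <= N (\1_A).
  by rewrite -[leRHS](mulVKf (lt0r_neq0 f0)) ler_pM2l.
have h5 : rho (\1_A) * (e + kap) <= e + kap by rewrite ler_piMl ?rho_indic_le1// addr_ge0.
by clear - h4 h5; lra.
Qed.

(** Exchange of the part of G where the density of N is at most a with the
    part of D where it is at least b. *)
Lemma two_level_gap N A G D H0 H1 (kap e a b : R) : dominated E rho N ->
  measurable A -> measurable G -> measurable D -> measurable H0 -> measurable H1 ->
  0 < rho (\1_A) -> 0 < kap <= 1 -> 0 <= e -> a <= b ->
  D `<=` I01 -> (forall s, G s -> ~ A s) -> (forall s, D s -> ~ A s) ->
  (forall s, D s -> ~ G s) ->
  (1 - e) * rho (two_level A G kap) < N (two_level A G kap) ->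
  below N a e H0 -> above N b e (~` H1) ->
  (b - a) * kap * (meas (G `&` H0) * meas (D `\` H1) / 3) <= 4 * e.
Proof.
move=> dN mA mG mD mH0 mH1 f0 /andP[kap0 kap1] e0 ab DI GA DA DG Nx bel abv.
have [Ex /andP[_ x2]] := two_level_norm mA mG f0 (ltW kap0).
have xG s : G s -> two_level A G kap s = kap.
  move=> Gs; rewrite /two_level/= !indicE (memNset (GA _ Gs)) (mem_set Gs).
  by rewrite mulr1 mulr0 add0r.
have xD s : D s -> two_level A G kap s = 0.
  move=> Ds; rewrite /two_level/= !indicE (memNset (DA _ Ds)) (memNset (DG _ Ds)).
  by rewrite !mulr0 addr0.
have mGH : measurable (G `&` H0) by exact: measurableI.
have mP : measurable (G `&` H0 `&` I01) by apply: measurableI => //; exact: measurable_itv.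
have mQ : measurable (D `\` H1) by exact: measurableD.
have PI : G `&` H0 `&` I01 `<=` I01 by exact: subIsetr.
have QI : D `\` H1 `<=` I01 by move=> s [/DI].
have PQ s : (G `&` H0 `&` I01) s -> ~ (D `\` H1) s by move=> [[Gs _] _] [/DG].
have xP s : (G `&` H0 `&` I01) s -> kap <= two_level A G kap s <= kap.
  by move=> [[/xG -> _] _]; rewrite lexx.
have xQ s : (D `\` H1) s -> two_level A G kap s <= 0 by move=> [/xD ->].
have bP : below N a e (G `&` H0 `&` I01) by apply: belowS bel => s [[]].
have aQ : above N b e (D `\` H1) by apply: aboveS abv => s [].
have := exchange_gain snE dN Ex mP mQ PI QI PQ (ltW kap0) kap0 ab xP xQ bP aQ.
rewrite meas_I01// subr0 => gain.
have h1 : e * rho (two_level A G kap) <= e * 2.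
  by rewrite ler_wpM2l// (le_trans x2)// -[leRHS]/(1 + 1) lerD2l.
have h2 : e * kap <= e by rewrite ler_piMr.
by clear - Nx gain h1 h2; lra.
Qed.

(** Exchange of D, where w >= p and the density is at most a, with the part of
    A where w <= p / 2 and the density is at least b.  Since the integral of w
    is at most 2, the removed parts {w > M} and {w > p / 2} have measure at most
    2 / M and 4 / p. *)
Lemma spike_spread N w A D H1 H2 (e a b p M : R) : dominated E rho N -> E w ->
  measurable A -> measurable D -> measurable H1 -> measurable H2 ->
  0 <= e <= 1 -> rho w <= 1 + e -> 1 - e < N w -> 0 < p -> 0 < M -> a <= b ->
  D `<=` I01 -> (forall s, D s -> ~ A s) -> (forall s, D s -> p <= w s) ->
  below N a e H1 -> above N b e (~` H2) ->
  2 / M <= meas (D `&` H1) -> 4 / p <= meas (A `\` H2) ->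
  (b - a) * (p / 2) * ((meas (D `&` H1) - 2 / M) * (meas (A `\` H2) - 4 / p) / 3)
    <= 2 * e + 2 * e * M.
Proof.
move=> dN Ew mA mD mH1 mH2 /andP[e0 e1] rhow Nw p0 M0 ab DI DA Dw bel abv MD pA.
have rhow2 : rho w <= 2 by apply: (le_trans rhow); rewrite -[leRHS]/(1 + 1) lerD2l.
have mw := sn_measurable snE Ew.
have p20 : 0 < p / 2 by rewrite divr_gt0.
have mSM := measurable_sublevel M mw; have mSp := measurable_sublevel (p / 2) mw.
set SM := [set s | w s <= M] in mSM; set Sp := [set s | w s <= p / 2] in mSp.
have mC : measurable (D `&` H1) by exact: measurableI.
have mB : measurable (A `\` H2) by exact: measurableD.
have mP : measurable (D `&` H1 `&` SM) by exact: measurableI.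
have mBS : measurable ((A `\` H2) `&` Sp) by exact: measurableI.
have mQ : measurable ((A `\` H2) `&` Sp `&` I01).
  by apply: measurableI => //; exact: measurable_itv.
have trim B S (v : R) : measurable B -> measurable S -> meas (~` S) <= v ->
    meas B - v <= meas (B `&` S).
  move=> mB' mS Sv; rewrite (meas_setD mB' mS) lerBlDr lerD2l (le_trans _ Sv)//.
  by apply: meas_le; [exact: measurableD|exact: measurableC|move=> s []].
have PM : meas (D `&` H1) - 2 / M <= meas (D `&` H1 `&` SM).
  apply: trim => //; apply: (le_trans (markov_rho Ew M0)).
  by rewrite ler_pM2r ?invr_gt0.
have Qp : meas (A `\` H2) - 4 / p <= meas ((A `\` H2) `&` Sp `&` I01).
  rewrite meas_I01//; apply: trim => //; apply: (le_trans (markov_rho Ew p20)).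
  have -> : rho w / (p / 2) = 2 * rho w / p by field; rewrite gt_eqF.
  rewrite ler_pM2r ?invr_gt0//.
  by clear - rhow2; lra.
have PI : D `&` H1 `&` SM `<=` I01 by move=> s [[/DI]].
have QI : (A `\` H2) `&` Sp `&` I01 `<=` I01 by move=> s [].
have PQ s : (D `&` H1 `&` SM) s -> ~ ((A `\` H2) `&` Sp `&` I01) s.
  by move=> [[/DA nA _] _] [[[]]].
have wP s : (D `&` H1 `&` SM) s -> p <= w s <= M by move=> [[/Dw -> _] ->].
have wQ s : ((A `\` H2) `&` Sp `&` I01) s -> w s <= p / 2 by move=> [[]].
have bP : below N a e (D `&` H1 `&` SM) by apply: belowS bel => s [[]].
have aQ : above N b e ((A `\` H2) `&` Sp `&` I01) by apply: aboveS abv => s [[[]]].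
have p2p : p / 2 <= p by clear - p0; lra.
have := exchange_gain snE dN Ew mP mQ PI QI PQ p2p M0 ab wP wQ bP aQ.
have -> : p - p / 2 = p / 2 by field.
move=> gain; apply: (@le_trans _ _ ((b - a) * (p / 2) *
  (meas (D `&` H1 `&` SM) * meas ((A `\` H2) `&` Sp `&` I01) / 3))).
  apply: ler_wpM2l; first by rewrite mulr_ge0 ?(ltW p20)// subr_ge0.
  by rewrite ler_pM2r ?invr_gt0// ler_pM// subr_ge0.
by clear - gain rhow Nw; lra.
Qed.

(** With f = ||1_A|| = (1 + 6 dl) mu(A), the density levels 1 + dl < 1 + 2 dl <
    1 + 3 dl separate G, D and A.  The order of the choices matters: dl and kap
    depend on A; then bet, a lower bound for the measure of the high part of A;
    then D, small relative to bet; and e last, small relative to everything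
    else. *)
Lemma lush_cone_indic A : lush_cone E rho -> measurable A -> rho (\1_A) <= meas A.
Proof.
move=> lushE mA; rewrite leNgt; apply/negP.
set t := meas A; set f := rho (\1_A) => tf.
have f1 : f <= 1 by exact: rho_indic_le1.
have t0 : 0 < t.
  rewrite lt_neqAle meas_ge0 andbT; apply/eqP => t0.
  have f0 : 0 < f by rewrite (le_lt_trans _ tf)// meas_ge0.
  have [s s0 /(_ A mA)] := sn_abs_cont snE f0.
  by rewrite -/t -t0 => /(_ s0); rewrite ltxx.
have f0 : 0 < f by exact: lt_trans tf.
pose dl := (f / t - 1) / 6.
have dl0 : 0 < dl by rewrite divr_gt0// subr_gt0 ltr_pdivlMr// mul1r.
have fE : f = t + 6 * (dl * t) by rewrite /dl; field; rewrite gt_eqF.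
have dl1 : 0 < 1 + dl by rewrite addr_gt0.
have dlt0 : 0 < dl * t / 2 by rewrite divr_gt0// mulr_gt0.
have [bet bet0 Hbet] := sn_abs_cont snE dlt0.
have bet80 : 0 < bet / 8 by rewrite divr_gt0.
have [s1 s10 Hs1] := sn_abs_cont snE bet80.
have mAC : meas (~` A) = 1 - t.
  by have := meas_setD measurableT mA; rewrite setTI setTD meas_setT -/t => ->; rewrite addrC addKr.
have AC0 : 0 < meas (~` A) by rewrite mAC subr_gt0 (lt_le_trans tf).
(* The second bound makes (1 + dl) d negligible against dl in [gamG]. *)
have min0 : 0 < Num.min s1 (dl / (4 * (1 + dl))) by rewrite lt_min s10 divr_gt0// mulr_gt0.
have [D [mD DAI]] := small_subset (measurableC mA) AC0 min0.
set d := meas D => d0; rewrite lt_min => /andP[/(Hs1 _ mD)].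
set fD := rho (\1_D) => fDbet; rewrite ltr_pdivlMr ?mulr_gt0// => ddl.
have fD0 : 0 < fD by apply: lt_le_trans d0 _; exact: (meas_le_rho snE).
have DI : D `<=` I01 by move=> s /DAI[].
have DA s : D s -> ~ A s by move=> /DAI[].
pose G := ~` A `\` D.
have mG : measurable G by apply: measurableD => //; exact: measurableC.
have GA s : G s -> ~ A s by case.
have DG s : D s -> ~ G s by move=> Ds [].
have measG : meas G = 1 - t - d.
  have := meas_setD (measurableC mA) mD; rewrite mAC -/G.
  by rewrite (_ : ~` A `&` D = D) => [->|]; [rewrite -/d addrC addKr|apply/setIidr => s /DA].
pose kap := dl * t / 2.
have kap1 : kap <= 1 by rewrite /kap; clear - fE f1 t0 dlt0; lra.
pose gam := dl / (2 * (1 + dl)).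
have gam0 : 0 < gam by rewrite divr_gt0// mulr_gt0.
(* Then {w > M} has measure at most 2 / M = d / 4. *)
pose M := 8 / d.
have M0 : 0 < M by rewrite divr_gt0.
have b3 : 0 < dl * kap * gam * d / 24.
  by apply: divr_gt0 => //; do 3?[apply: mulr_gt0 => //].
(* A lower bound for the left-hand side of [spike_spread]; e is chosen so that
   the right-hand side 2 e + 2 e M is smaller. *)
pose gain := dl * (fD^-1 / 2) * (d / 4 * (bet / 2) / 3).
have gain0 : 0 < gain.
  by rewrite /gain; do 6?[apply: divr_gt0 => // || apply: mulr_gt0 => //]; rewrite invr_gt0.
have b4 : 0 < gain / (3 + 2 * M) by rewrite divr_gt0// addr_gt0// mulr_gt0.
have b1 : 0 < Num.min 1 (dl / 4) by rewrite lt_min ltr01 divr_gt0.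
have [e [e0]] := small_enough4 b1 dlt0 b3 b4.
rewrite le_min => /andP[e1 edl] edlt e3 e4.
have [N [w [dN Nx Ew Dw [rhow Nw]]]] :=
  lush_cone_witness lushE mA mG mD f0 fD0 (ltW dlt0 : 0 <= kap) e0.
have e01 : 0 <= e <= 1 by rewrite ltW.
have NA : f - (e + kap) <= N (\1_A) by exact: two_level_dom dN mA mG f0 (ltW dlt0) e01 Nx.
have split (c : R) : 0 <= c -> exists H,
    [/\ measurable H, below N (1 + c * dl) e H & above N (1 + c * dl) e (~` H)].
  by move=> c0; apply: (dominated_split snE) => //; rewrite addr_ge0// mulr_ge0// ltW.
have [H0 [mH0 bel0 abv0]] := split 1 ler01.
have [H1 [mH1 bel1 abv1]] := split 2 (ler0n _ _).
have [H2 [mH2 bel2 abv2]] := split 3 (ler0n _ _).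
have betB : bet <= meas (A `\` H2).
  apply: (high_part_meas dN _ mA mH2 bel2 Hbet).
    by rewrite addr_ge0// mulr_ge0// ltW.
  apply: le_trans NA; rewrite -/t /kap fE.
  by clear - edlt dlt0; lra.
have gamG : gam <= meas (G `&` H0).
  have NG : N (\1_G) <= 1 - (f - (e + kap)).
    rewrite lerBrDr (le_trans _ (dom_indic_le1 dN (measurableU _ _ mG mA)))//.
    by rewrite (indicD GA) (dom_add dN (E_indic snE mG) (E_indic snE mA)) lerD2l.
  have := low_part_meas dN mG mH0 abv0 NG; rewrite measG fE /kap => h.
  rewrite ler_pdivrMr ?mulr_gt0//.
  by clear - h edl edlt ddl dlt0; lra.
have dQ : meas (D `\` H1) <= d / 2.
  have kap01 : 0 < kap <= 1 by rewrite kap1 andbT.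
  have levels : 1 + 1 * dl <= 1 + 2 * dl by rewrite lerD2l ler_pM2r// ler1n.
  have := two_level_gap dN mA mG mD mH0 mH1 f0 kap01 (ltW e0) levels DI GA DA DG Nx bel0 abv1.
  have -> : 1 + 2 * dl - (1 + 1 * dl) = dl by ring.
  move=> h; rewrite leNgt; apply/negP => h'.
  have h1 : gam * (d / 2) < meas (G `&` H0) * meas (D `\` H1).
    apply: (@lt_le_trans _ _ (gam * meas (D `\` H1))); first by rewrite ltr_pM2l.
    by rewrite ler_wpM2r// meas_ge0.
  have h2 : dl * kap * (gam * (d / 2)) < dl * kap * (meas (G `&` H0) * meas (D `\` H1)).
    by rewrite ltr_pM2l// mulr_gt0.
  by clear - h h2 e3; lra.
have C2 : d / 2 <= meas (D `&` H1).
  by have := meas_setD mD mH1; rewrite -/d; clear - dQ; lra.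
have fDV0 : 0 < fD^-1 by rewrite invr_gt0.
have levels : 1 + 2 * dl <= 1 + 3 * dl by rewrite lerD2l ler_pM2r// ler_nat.
have M2 : 2 / M = d / 4 by rewrite /M; field; rewrite gt_eqF.
have hC : d / 4 <= meas (D `&` H1) - 2 / M by rewrite M2; clear - C2; lra.
have hB : bet / 2 <= meas (A `\` H2) - 4 / fD^-1 by rewrite invrK; clear - betB fDbet; lra.
have hC0 : 2 / M <= meas (D `&` H1) by rewrite -subr_ge0 (le_trans _ hC)// divr_ge0// ltW.
have hB0 : 4 / fD^-1 <= meas (A `\` H2) by rewrite -subr_ge0 (le_trans _ hB)// divr_ge0// ltW.
have := spike_spread dN Ew mA mD mH1 mH2 e01 rhow Nw fDV0 M0 levels DI DA Dw bel1 abv2 hC0 hB0.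
have -> : 1 + 3 * dl - (1 + 2 * dl) = dl by ring.
have le_gain : gain <= dl * (fD^-1 / 2) *
    ((meas (D `&` H1) - 2 / M) * (meas (A `\` H2) - 4 / fD^-1) / 3).
  apply: ler_wpM2l; first by apply: mulr_ge0; [exact: ltW|rewrite divr_ge0// ltW].
  by rewrite ler_pM2r ?invr_gt0// ler_pM// divr_ge0// ltW.
have : e * (3 + 2 * M) <= gain by rewrite -ler_pdivlMr// addr_gt0// mulr_gt0.
by clear - le_gain e0; lra.
Qed.

End LushCone.

(** * Real and complex scalars *)

Section Scalars.
Context {R : realType} {k : scalar_kind}.
Local Notation K := (scalars_of R k).
Implicit Types (a b z : K) (r s : R).

Definition emb r : K := of_re_im K r 0.

Lemma reD a b : re (a + b) = re a + re b.
Proof. by case: k a b => //= -[? ?] [? ?]. Qed.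

Lemma imD a b : im (a + b) = im a + im b.
Proof. by case: k a b => /= [_ _|[? ?] [? ?]] //; rewrite addr0. Qed.

Lemma reN a : re (- a) = - re a.
Proof. by case: k a => //= -[? ?]. Qed.

Lemma imN a : im (- a) = - im a.
Proof. by case: k a => /= [_|[? ?]] //; rewrite oppr0. Qed.

Lemma reM a b : re (a * b) = re a * re b - im a * im b.
Proof. by case: k a b => /= [a b|[? ?] [? ?]] //; rewrite mul0r subr0. Qed.

Lemma imM a b : im (a * b) = re a * im b + im a * re b.
Proof. by case: k a b => /= [a b|[? ?] [? ?]] //; rewrite mul0r mulr0 addr0. Qed.

Lemma re_emb r : re (emb r) = r. Proof. by rewrite /emb; case: k. Qed.
Lemma im_emb r : im (emb r) = 0. Proof. by rewrite /emb; case: k. Qed.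

Lemma scalar_eq a b : re a = re b -> im a = im b -> a = b.
Proof. by case: k a b => //= -[? ?] [? ?] /= -> ->. Qed.

Lemma emb0 : emb 0 = 0. Proof. by rewrite /emb; case: k. Qed.
Lemma emb1 : emb 1 = 1. Proof. by rewrite /emb; case: k. Qed.

Lemma embD r s : emb (r + s) = emb r + emb s.
Proof. by apply: scalar_eq; rewrite ?(reD, imD, re_emb, im_emb) ?addr0. Qed.

Lemma embM r s : emb (r * s) = emb r * emb s.
Proof. by apply: scalar_eq; rewrite ?(reM, imM, re_emb, im_emb) ?(mul0r, mulr0, subr0, addr0). Qed.

Lemma embN r : emb (- r) = - emb r.
Proof. by apply: scalar_eq; rewrite ?(reN, imN, re_emb, im_emb) ?oppr0. Qed.

Lemma ler_emb r s : (emb r <= emb s) = (r <= s).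
Proof. by rewrite /emb; case: k => //=; rewrite lecE/= eqxx. Qed.

Lemma ltr_emb r s : (emb r < emb s) = (r < s).
Proof. by rewrite /emb; case: k => //=; rewrite ltcE/= eqxx. Qed.

Lemma norm_modulus a : `|a| = emb (modulus a).
Proof.
apply: scalar_eq; rewrite ?re_emb ?im_emb//.
by case: k a => /= [a|[x y]].
Qed.

Lemma modulusE a : modulus a = Num.sqrt (re a ^+ 2 + im a ^+ 2).
Proof.
rewrite /modulus; case: k a => /= [a|[x y]] //.
  by rewrite expr0n/= addr0 sqrtr_sqr.
Qed.

Lemma modulus_ge0 a : 0 <= modulus a.
Proof. by rewrite modulusE sqrtr_ge0. Qed.

Lemma modulusM a b : modulus (a * b) = modulus a * modulus b.
Proof.
by rewrite {1}/modulus normrM !norm_modulus -embM re_emb.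
Qed.

Lemma modulusD a b : modulus (a + b) <= modulus a + modulus b.
Proof. by have := ler_normD a b; rewrite !norm_modulus -embD ler_emb. Qed.

Lemma modulusN a : modulus (- a) = modulus a.
Proof. by rewrite /modulus normrN. Qed.

Lemma modulus0 : modulus (0 : K) = 0.
Proof. by rewrite /modulus normr0 -emb0 re_emb. Qed.

Lemma modulus_eq0 a : modulus a = 0 -> a = 0.
Proof. by move=> h; apply/eqP; rewrite -normr_eq0 norm_modulus h emb0. Qed.

Lemma modulus_emb r : modulus (emb r) = `|r|.
Proof. by rewrite modulusE re_emb im_emb expr0n addr0 sqrtr_sqr. Qed.

Lemma norm_re a : `|re a| <= modulus a.
Proof. by rewrite modulusE -sqrtr_sqr ler_wsqrtr// lerDl sqr_ge0. Qed.

Lemma norm_im a : `|im a| <= modulus a.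
Proof. by rewrite modulusE -sqrtr_sqr ler_wsqrtr// lerDr sqr_ge0. Qed.

Lemma le_re a : re a <= modulus a.
Proof. exact: le_trans (ler_norm _) (norm_re a). Qed.

Lemma modulus_le_re_im a : modulus a <= `|re a| + `|im a|.
Proof.
rewrite modulusE -[leRHS]ger0_norm ?addr_ge0// -sqrtr_sqr ler_wsqrtr//.
rewrite sqrrD !real_normK ?num_real// -addrA lerD2l lerDr.
by rewrite mulrn_wge0// mulr_ge0.
Qed.

Section NormedModule.
Context {V : normedModType K}.
Implicit Types (x y : V).

Lemma norm_vnorm x : `|x| = emb (vnorm x).
Proof.
have h : `|x| = `| `|x| | by rewrite normr_id.
by rewrite [LHS]h norm_modulus /modulus -h.
Qed.

Lemma vnorm_ge0 x : 0 <= vnorm x.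
Proof. by rewrite -ler_emb emb0 -norm_vnorm. Qed.

Lemma vnormD x y : vnorm (x + y) <= vnorm x + vnorm y.
Proof. by have := ler_normD x y; rewrite !norm_vnorm -embD ler_emb. Qed.

Lemma vnormN x : vnorm (- x) = vnorm x.
Proof. by rewrite /vnorm normrN. Qed.

Lemma vnormZ a x : vnorm (a *: x) = modulus a * vnorm x.
Proof. by rewrite {1}/vnorm normrZ norm_vnorm norm_modulus -embM re_emb. Qed.

Lemma vnorm0 : vnorm (0 : V) = 0.
Proof. by rewrite /vnorm normr0 -emb0 re_emb. Qed.

Lemma vnorm_eq0 x : vnorm x = 0 -> x = 0.
Proof. by move=> h; apply/eqP; rewrite -normr_eq0 norm_vnorm h emb0. Qed.

Lemma ball_vnorm x y r : ball x (emb r) y <-> vnorm (x - y) < r.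
Proof.
by rewrite -ball_normE /ball_/= norm_vnorm ltr_emb.
Qed.

Lemma dual_sphere_bound (phi : {scalar V}) x : dual_sphere phi ->
  modulus (phi x) <= vnorm x.
Proof.
move=> [_ phi1].
have [x0|x0] := eqVneq (vnorm x) 0.
  by rewrite (vnorm_eq0 x0) linear0 modulus0 vnorm0.
have xp : 0 < vnorm x by rewrite lt_neqAle eq_sym x0 vnorm_ge0.
pose u := emb (vnorm x)^-1 *: x.
have u1 : vnorm u = 1.
  by rewrite vnormZ modulus_emb ger0_norm ?invr_ge0 ?vnorm_ge0// mulVf.
have : ((modulus (phi u))%:E <= 1%:E)%E.
  rewrite -phi1; apply: ereal_sup_ubound; exists u => //; split => //.
  by rewrite u1.
rewrite lee_fin /u linearZ modulusM modulus_emb ger0_norm ?invr_ge0 ?vnorm_ge0//.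
by rewrite mulrC ler_pdivrMr// mul1r.
Qed.

End NormedModule.

End Scalars.

(** * The positive cone of a function space *)

Section MeasurableScalarFunctions.
Context {R : realType} {k : scalar_kind}.
Local Notation K := (scalars_of R k).
Local Notation T := (measurableTypeR R).
Implicit Types (F G : T -> K) (f g : T -> R).
Local Notation intble f := (mu01.-integrable [set: T] (EFin \o f)).

Lemma kmeasurable_emb f : measurable_fun setT f -> kmeasurable (fun t => emb (f t) : K).
Proof.
move=> mf; split; first by rewrite (_ : (fun t => _) = f)//; apply/funext => t; rewrite re_emb.
rewrite (_ : (fun t => _) = cst 0); first exact: measurable_cst.
by apply/funext => t; rewrite im_emb.
Qed.

Lemma kmeasurable_cst (a : K) : kmeasurable (fun=> a : K).
Proof. by split; exact: measurable_cst. Qed.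

Lemma kmeasurableD F G : kmeasurable F -> kmeasurable G -> kmeasurable (fun t => F t + G t).
Proof.
move=> [rF iF] [rG iG]; split.
  rewrite (_ : (fun t => _) = (fun t => re (F t)) \+ (fun t => re (G t))).
    exact: measurable_funD.
  by apply/funext => t; rewrite reD.
rewrite (_ : (fun t => _) = (fun t => im (F t)) \+ (fun t => im (G t))).
  exact: measurable_funD.
by apply/funext => t; rewrite imD.
Qed.

Lemma kmeasurableM F G : kmeasurable F -> kmeasurable G -> kmeasurable (fun t => F t * G t).
Proof.
move=> [rF iF] [rG iG]; split.
  rewrite (_ : (fun t => _) = ((fun t => re (F t)) \* (fun t => re (G t))) \-
     ((fun t => im (F t)) \* (fun t => im (G t)))).
    by apply: measurable_funB; exact: measurable_funM.
  by apply/funext => t; rewrite reM.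
rewrite (_ : (fun t => _) = ((fun t => re (F t)) \* (fun t => im (G t))) \+
     ((fun t => im (F t)) \* (fun t => re (G t)))).
  by apply: measurable_funD; exact: measurable_funM.
by apply/funext => t; rewrite imM.
Qed.

Lemma measurable_modulus F : kmeasurable F -> measurable_fun setT (fun t => modulus (F t)).
Proof.
move=> [rF iF].
rewrite (_ : (fun t => _) = Num.sqrt \o
  ((fun t => re (F t) ^+ 2) \+ (fun t => im (F t) ^+ 2))); last first.
  by apply/funext => t; rewrite modulusE.
apply: measurableT_comp.
  by apply: continuous_measurable_fun; exact: sqrt_continuous.
by apply: measurable_funD; exact: measurable_funX.
Qed.

Lemma kintegrable_measurable F : kintegrable F -> kmeasurable F.
Proof. by move=> [/measurable_int/measurable_EFinP ? /measurable_int/measurable_EFinP ?]. Qed.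

Lemma kintegrableP F : kmeasurable F ->
  kintegrable F <-> intble (fun t => modulus (F t)).
Proof.
move=> mF; have mm := measurable_modulus mF; case: (mF) => rF iF; split.
- move=> [rI iI].
  apply: (@le_integrable _ _ _ mu01 _ measurableT _
    (fun t => (`|re (F t)| + `|im (F t)|)%:E)); first exact/measurable_EFinP.
    move=> t _ /=; rewrite lee_fin ger0_norm ?modulus_ge0// ger0_norm ?addr_ge0//.
    exact: modulus_le_re_im.
  rewrite (_ : (fun t => _) = (fun t => `|(re (F t))%:E|%E) \+ (fun t => `|(im (F t))%:E|%E))%E//.
  by apply: integrableD => //; exact: integrable_abse.
- move=> mI; split.
    apply: le_integrable mI => //; first exact/measurable_EFinP.
    by move=> t _ /=; rewrite lee_fin [leRHS]ger0_norm ?modulus_ge0// norm_re.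
  apply: le_integrable mI => //; first exact/measurable_EFinP.
  by move=> t _ /=; rewrite lee_fin [leRHS]ger0_norm ?modulus_ge0// norm_im.
Qed.

Lemma Lpnorm1E F : Lpnorm 1 F = (\int[mu01]_t (modulus (F t))%:E)%E.
Proof.
rewrite /Lpnorm Lnorm1; apply: eq_integral => t _.
by rewrite /= ger0_norm ?modulus_ge0.
Qed.

End MeasurableScalarFunctions.

Section FunctionSpace.
Context {R : realType} {k : scalar_kind}.
Local Notation K := (scalars_of R k).
Local Notation T := (measurableTypeR R).
Local Notation intble f := (mu01.-integrable [set: T] (EFin \o f)).
Context {X : completeNormedModType K} (fn : X -> T -> K).
Hypothesis ri : ri_space fn.
Implicit Types (x y z v : X) (F G : T -> K) (f g : T -> R) (A : set T).

Local Notation repr := (represents fn).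

Lemma ae_equal_refl F : ae_equal F F.
Proof. exact: aeW. Qed.

Lemma ae_equal_sym F G : ae_equal F G -> ae_equal G F.
Proof. by apply: filterS => t ->. Qed.

Lemma ae_equal_trans F G H : ae_equal F G -> ae_equal G H -> ae_equal F H.
Proof. by apply: filterS2 => t ->. Qed.

Lemma repr_self x : repr x (fn x).
Proof. exact: ae_equal_refl. Qed.

Lemma repr_uniq x y F : repr x F -> repr y F -> x = y.
Proof.
by move=> xF yF; apply: (kothe_inj (ri_kothe ri)); apply: (ae_equal_trans xF); exact: ae_equal_sym.
Qed.

Lemma eq_repr x F G : F =1 G -> repr x F -> repr x G.
Proof. by move=> /funext ->. Qed.

Lemma repr_lin (a : K) x y F G : repr x F -> repr y G -> repr (a *: x + y) (fun t => a * F t + G t).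
Proof.
move=> xF yG; have h := kothe_linear (ri_kothe ri) a x y.
apply: (ae_equal_trans h); rewrite /ae_equal.
by apply: filterS2 xF yG => t -> ->.
Qed.

Lemma repr0 : repr 0 (fun=> 0).
Proof.
have := repr_lin (-1) (repr_self 0) (repr_self 0); rewrite scaler0 addr0.
by apply: eq_repr => t; rewrite mulN1r addNr.
Qed.

Lemma reprD x y F G : repr x F -> repr y G -> repr (x + y) (fun t => F t + G t).
Proof. by move=> xF /(repr_lin 1 xF); rewrite scale1r; apply: eq_repr => t; rewrite mul1r. Qed.

Lemma reprZ (a : K) x F : repr x F -> repr (a *: x) (fun t => a * F t).
Proof. by move=> /(repr_lin a)/(_ repr0); rewrite addr0; apply: eq_repr => t; rewrite addr0. Qed.

Lemma reprB x y F G : repr x F -> repr y G -> repr (x - y) (fun t => F t - G t).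
Proof.
move=> xF yG; have := repr_lin (-1) yG xF; rewrite scaleN1r addrC.
by apply: eq_repr => t; rewrite mulN1r addrC.
Qed.

Lemma fn_measurable x : kmeasurable (fn x).
Proof. exact/kintegrable_measurable/(kothe_integrable (ri_kothe ri)). Qed.

Lemma repr_ideal x F G : repr x G -> kmeasurable F ->
  (\forall t \ae mu01, modulus (F t) <= modulus (G t)) ->
  exists2 y, repr y F & vnorm y <= vnorm x.
Proof.
move=> xG mF FG; apply: (kothe_ideal (ri_kothe ri)) => //.
by apply: filterS2 xG FG => t ->.
Qed.

(** The non-negative functions with a class in X, as real functions on the
    whole line. *)
Definition cone : set (T -> R) := [set f : T -> R |
  [/\ measurable_fun setT f, forall t, 0 <= f t & exists x, repr x (fun t => emb (f t))]].

Definition class f : X := xget 0 [set x | repr x (fun t => emb (f t))].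

Definition cone_norm f : R := vnorm (class f).

Lemma classP f : cone f -> repr (class f) (fun t => emb (f t)).
Proof. by move=> [_ _ [x xf]]; rewrite /class; case: xgetP => [y ->|/(_ x)]. Qed.

Lemma class_eq f x : repr x (fun t => emb (f t)) -> class f = x.
Proof.
move=> xf; rewrite /class; case: xgetP => [y _ yf|/(_ x)//].
exact: repr_uniq xf.
Qed.

Lemma cone_normE f x : repr x (fun t => emb (f t)) -> cone_norm f = vnorm x.
Proof. by move=> /class_eq; rewrite /cone_norm => ->. Qed.

Definition absf x (t : T) : R := modulus (fn x t).

Lemma vnorm_le_ae x y F G : repr x F -> repr y G ->
  (\forall t \ae mu01, modulus (F t) <= modulus (G t)) -> vnorm x <= vnorm y.
Proof.
move=> xF yG FG.
have [z zx zy] : exists2 z, repr z (fn x) & vnorm z <= vnorm y.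
  apply: (repr_ideal yG (fn_measurable x)).
  by apply: filterS2 xF FG => t ->.
by rewrite (repr_uniq (repr_self x) zx).
Qed.

Lemma absf_cone x : cone (absf x) /\ cone_norm (absf x) = vnorm x.
Proof.
have mx := measurable_modulus (fn_measurable x).
have am t : modulus (emb (absf x t) : K) = modulus (fn x t).
  by rewrite modulus_emb ger0_norm ?modulus_ge0.
have [y yx _] : exists2 y, repr y (fun t => emb (absf x t)) & vnorm y <= vnorm x.
  apply: (repr_ideal (repr_self x) (kmeasurable_emb mx)).
  by apply: aeW => t; rewrite am.
split; first by split => //; [move=> t; exact: modulus_ge0|exists y].
rewrite (cone_normE yx); apply/eqP; rewrite eq_le.
rewrite (vnorm_le_ae yx (repr_self x)) ?(vnorm_le_ae (repr_self x) yx)//;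
  by apply: aeW => t; rewrite am.
Qed.

Lemma repr_int x F : repr x F -> kmeasurable F ->
  intble (fun t => modulus (F t)) /\ \int[mu01]_t modulus (F t) <= vnorm x.
Proof.
move=> xF mF; have [fi f1] := ri_L1 ri x.
move/(kintegrableP (fn_measurable x)): fi => fi.
rewrite Lpnorm1E in f1.
have mm := measurable_modulus mF.
have Ieq : (\int[mu01]_t (modulus (F t))%:E = \int[mu01]_t (modulus (fn x t))%:E)%E.
  apply: ae_eq_integral => //.
  - exact/measurable_EFinP.
  - by apply/measurable_EFinP; apply: measurable_modulus; exact: fn_measurable.
  - by apply: filterS xF => t -> _.
have Ile : (\int[mu01]_t (modulus (F t))%:E <= (vnorm x)%:E)%E by rewrite Ieq.
have I0 : (0 <= \int[mu01]_t (modulus (F t))%:E)%E.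
  by apply: integral_ge0 => t _; rewrite lee_fin modulus_ge0.
split.
  apply/integrableP; split; first exact/measurable_EFinP.
  rewrite (_ : (fun t => _) = (fun t => (modulus (F t))%:E)); last first.
    by apply/funext => t /=; rewrite ger0_norm ?modulus_ge0.
  by rewrite (le_lt_trans Ile)// ltey.
rewrite -lee_fin /Rintegral fineK// ge0_fin_numE//.
by rewrite (le_lt_trans Ile)// ltey.
Qed.

Lemma modulus_emb_ge0 f (t : T) : 0 <= f t -> modulus (emb (f t) : K) = f t.
Proof. by move=> f0; rewrite modulus_emb ger0_norm. Qed.

Lemma cone_solid f g : cone g -> measurable_fun setT f ->
  (forall t, 0 <= f t <= g t) -> cone f /\ cone_norm f <= cone_norm g.
Proof.
move=> cg mf fg; have f0 t : 0 <= f t by case/andP: (fg t).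
have g0 t : 0 <= g t by case: cg.
have [y yf yg] : exists2 y, repr y (fun t => emb (f t)) & vnorm y <= cone_norm g.
  apply: (repr_ideal (classP cg) (kmeasurable_emb mf)).
  by apply: aeW => t; rewrite !modulus_emb_ge0//; case/andP: (fg t).
by split; [split => //; exists y|rewrite (cone_normE yf)].
Qed.

Lemma cone_add f g : cone f -> cone g ->
  cone (f \+ g) /\ cone_norm (f \+ g) <= cone_norm f + cone_norm g.
Proof.
move=> cf cg.
have h : repr (class f + class g) (fun t => emb ((f \+ g) t)).
  by apply: eq_repr (reprD (classP cf) (classP cg)) => t; rewrite -embD.
split; last by rewrite (cone_normE h); exact: vnormD.
case: cf cg => mf f0 _ [mg g0 _]; split; last by exists (class f + class g).
  exact: measurable_funD.
by move=> t /=; rewrite addr_ge0.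
Qed.

Lemma cone_scale (c : R) f : 0 <= c -> cone f ->
  cone (fun t => c * f t) /\ cone_norm (fun t => c * f t) = c * cone_norm f.
Proof.
move=> c0 cf.
have h : repr ((emb c : K) *: class f) (fun t => emb (c * f t)).
  by apply: eq_repr (reprZ (emb c) (classP cf)) => t; rewrite -embM.
split; last by rewrite (cone_normE h) vnormZ modulus_emb ger0_norm.
case: cf => mf f0 _; split; last by exists ((emb c : K) *: class f).
  exact: measurable_funM.
by move=> t; rewrite mulr_ge0.
Qed.

Lemma cone_one : cone (cst 1) /\ cone_norm (cst 1) <= 1.
Proof.
pose F (t : T) : K := emb (cst 1 t).
have m1 : kmeasurable F by exact: kmeasurable_emb.
have L1 : (Lpnorm +oo F <= 1)%E.
  rewrite /Lpnorm unlock mu01_setT lte_fin ltr01.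
  apply/ess_supP; apply: aeW => t /=.
  by rewrite /F modulus_emb !normr1 lexx.
have [x xf xle] := ri_Loo ri m1 (le_lt_trans L1 (ltey _)).
split; first by split => //; exists x.
by rewrite (cone_normE xf) -lee_fin; exact: le_trans xle L1.
Qed.

Lemma cone_L1 f : cone f -> intble f /\ \int[mu01]_t f t <= cone_norm f.
Proof.
move=> cf; have f0 t : 0 <= f t by case: cf.
have fE : (fun t => modulus (emb (f t) : K)) = f.
  by apply/funext => t; rewrite modulus_emb_ge0.
have mf : measurable_fun setT f by case: cf.
have := repr_int (classP cf) (kmeasurable_emb mf).
rewrite fE => -[fi fle]; by split; rewrite // -fE.
Qed.

Lemma cone_symmetric tau : measure_preserving_bijection tau tau ->
  forall f, cone f -> cone (f \o tau) /\ cone_norm (f \o tau) = cone_norm f.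
Proof.
move=> taub f cf; have mf : measurable_fun setT f by case: cf.
have mtau : measurable_fun setT tau by case: taub.
have f0 t : 0 <= f t by case: cf.
have mef := kmeasurable_emb (k := k) mf.
have ki : kintegrable (fun t => emb (f t) : K).
  apply/(kintegrableP mef).
  by rewrite (_ : _ \o _ = EFin \o f); [case: (cone_L1 cf)|apply/funext => t /=; rewrite modulus_emb_ge0].
have [h1 h2] := ri_invariant ri taub ki.
have [_ [y yf]] : funs fn ((fun t => emb (f t) : K) \o tau).
  by apply/h1; split => //; exists (class f); exact: classP.
split.
  split; [exact: measurableT_comp|by move=> t /=|by exists y].
by rewrite (cone_normE yf) /cone_norm (h2 _ _ (classP cf) yf).
Qed.

End FunctionSpace.

(** * From lush spaces to lush cones *)

Section LushFunctionSpace.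
Context {R : realType} {k : scalar_kind}.
Local Notation K := (scalars_of R k).
Local Notation T := (measurableTypeR R).
Local Notation intble f := (mu01.-integrable [set: T] (EFin \o f)).
Context {X : completeNormedModType K} (fn : X -> T -> K).
Hypothesis ri : ri_space fn.
Implicit Types (x y z v : X) (F G : T -> K) (f g : T -> R) (A : set T).

Local Notation repr := (represents fn).
Local Notation cone := (cone fn).
Local Notation cone_norm := (cone_norm fn).
Local Notation absf := (absf fn).
Local Notation class := (class fn).

Definition bounded_by f : set X := [set z | \forall t \ae mu01, modulus (fn z t) <= f t].

Lemma bounded_by_le f z : cone f -> bounded_by f z -> vnorm z <= cone_norm f.
Proof.
move=> cf zf; rewrite (cone_normE ri (classP cf)).
apply: (vnorm_le_ae ri (repr_self fn z) (classP cf)).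
by apply: filterS zf => t; rewrite modulus_emb_ge0//; case: cf.
Qed.

Lemma bounded_by_absf z : bounded_by (absf z) z.
Proof. exact: aeW. Qed.

Section Modulus.
Variable phi : {scalar X}.
Hypothesis phiS : dual_sphere phi.

(** The Riesz formula |phi|(f) = sup {Re phi(z) : |z| <= f}. *)
Definition functional_modulus f : R := sup [set re (phi z) | z in bounded_by f].

Local Notation N := functional_modulus.

Lemma functional_modulus_has_sup f : cone f ->
  has_sup [set re (phi z) | z in bounded_by f].
Proof.
move=> cf; split.
  exists (re (phi 0)), 0 => //.
  apply: filterS (repr0 ri) => t ->; rewrite modulus0; by case: cf.
exists (cone_norm f) => _ [z zf <-].
by apply: (le_trans (le_re _)); apply: (le_trans (dual_sphere_bound _ phiS)); exact: bounded_by_le.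
Qed.

Lemma functional_modulus_ub f z : cone f -> bounded_by f z -> re (phi z) <= N f.
Proof.
move=> cf zf; apply: ub_le_sup; last by exists z.
by have [] := functional_modulus_has_sup cf.
Qed.

Lemma functional_modulus_le f (c : R) : cone f ->
  (forall z, bounded_by f z -> re (phi z) <= c) -> N f <= c.
Proof.
move=> cf H; apply: ge_sup; first by have [] := functional_modulus_has_sup cf.
by move=> _ [z zf <-]; exact: H.
Qed.

Lemma functional_modulus_ge0 f : cone f -> 0 <= N f.
Proof.
move=> cf; apply: (@le_trans _ _ (re (phi 0))).
  by rewrite linear0 -(emb0 (R := R) (k := k)) re_emb.
apply: functional_modulus_ub => //.
by apply: filterS (repr0 ri) => t ->; rewrite modulus0; case: cf.
Qed.

Lemma functional_modulus_le_norm f : cone f -> N f <= cone_norm f.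
Proof.
move=> cf; apply: functional_modulus_le => // z zf.
by apply: (le_trans (le_re _)); apply: (le_trans (dual_sphere_bound _ phiS)); exact: bounded_by_le.
Qed.

(** The inequality <= is the Riesz decomposition: z with |z| <= f + g splits
    as q z + (1 - q) z with q = f / (f + g), and the two parts are dominated by f
    and by g. *)
Lemma functional_modulus_add f g : cone f -> cone g -> N (f \+ g) = N f + N g.
Proof.
move=> cf cg; have [cfg _] := cone_add ri cf cg.
have f0 t : 0 <= f t by case: cf.
have g0 t : 0 <= g t by case: cg.
apply/eqP; rewrite eq_le; apply/andP; split.
  apply: functional_modulus_le => // z zfg.
  pose q t := f t / (f t + g t).
  have q0 t : 0 <= q t by rewrite divr_ge0// addr_ge0.
  have q1 t : q t <= 1.
    rewrite /q; have [->|fg0] := eqVneq (f t + g t) 0; first by rewrite invr0 mulr0.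
    by rewrite ler_pdivrMr ?mul1r ?lerDl// lt_neqAle eq_sym fg0 addr_ge0.
  have qf t : q t * (f t + g t) = f t.
    rewrite /q; have [fg0|fg0] := eqVneq (f t + g t) 0; last by rewrite divfK.
    by rewrite fg0 mulr0; apply/eqP; rewrite eq_le f0 -fg0 lerDl g0.
  have mq : measurable_fun setT q.
    apply: measurable_funM; first by case: cf.
    rewrite (_ : (fun t => _) = (fun s : R => s `^ (-1)) \o (f \+ g)).
      by apply: measurableT_comp; [exact: measurable_powR|case: cfg].
    by apply/funext => t /=; rewrite powR_inv1// addr_ge0.
  have mqz : kmeasurable (fun t => emb (q t) * fn z t).
    by apply: kmeasurableM; [exact: kmeasurable_emb|exact: (fn_measurable ri)].
  have qzE t : modulus (emb (q t) * fn z t) = q t * modulus (fn z t).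
    by rewrite modulusM modulus_emb_ge0.
  have [z1 z1q _] : exists2 y, repr y (fun t => emb (q t) * fn z t) & vnorm y <= vnorm z.
    apply: (repr_ideal ri (repr_self fn z) mqz); apply: aeW => t.
    by rewrite qzE ler_piMl// modulus_ge0.
  have z1f : bounded_by f z1.
    apply: filterS2 z1q zfg => t -> h.
    by rewrite qzE -[leRHS]qf; exact: ler_wpM2l.
  have z2g : bounded_by g (z - z1).
    have h2 := reprB ri (repr_self fn z) z1q.
    apply: filterS2 h2 zfg => t -> h.
    rewrite -[X in X - _]mul1r -mulrBl -(emb1 (R := R)) -embN -embD modulusM modulus_emb ger0_norm ?subr_ge0//.
    have -> : g t = (1 - q t) * (f t + g t) by rewrite mulrBl mul1r qf addrAC subrr add0r.
    by rewrite ler_wpM2l// subr_ge0.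
  have -> : z = z1 + (z - z1) by rewrite addrC subrK.
  by rewrite linearD reD lerD ?functional_modulus_ub.
rewrite -lerBrDr; apply: functional_modulus_le => // z1 z1f.
rewrite lerBrDr -lerBrDl; apply: functional_modulus_le => // z2 z2g.
rewrite lerBrDl -reD -linearD; apply: functional_modulus_ub => //.
have h := reprD ri (repr_self fn z1) (repr_self fn z2).
have : \forall t \ae mu01, modulus (fn z1 t + fn z2 t) <= f t + g t.
  apply: filterS2 z1f z2g => t h1 h2.
  by apply: (le_trans (modulusD _ _)); exact: lerD.
by apply: filterS2 h => t ->.
Qed.

Lemma functional_modulus_scale_ge (c : R) f : 0 < c -> cone f ->
  c * N f <= N (fun t => c * f t).
Proof.
move=> c0 cf; have [ccf _] := cone_scale ri (ltW c0) cf.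
rewrite mulrC -ler_pdivlMr//; apply: functional_modulus_le => // z zf.
rewrite ler_pdivlMr// mulrC.
have -> : c * re (phi z) = re (phi (emb c *: z)).
  by rewrite linearZ reM re_emb im_emb mul0r subr0.
apply: functional_modulus_ub => //.
have h := reprZ ri (emb c) (repr_self fn z).
apply: filterS2 h zf => t -> h'.
by rewrite modulusM modulus_emb gtr0_norm// ler_pM2l.
Qed.

Lemma functional_modulus_scale (c : R) f : 0 <= c -> cone f ->
  N (fun t => c * f t) = c * N f.
Proof.
move=> c0 cf; have [ccf _] := cone_scale ri c0 cf.
have [cz|cn0] := eqVneq c 0.
  rewrite cz mul0r; apply/eqP; rewrite eq_le; apply/andP; split; last first.
    by apply: functional_modulus_ge0; rewrite -cz.
  apply: (le_trans (functional_modulus_le_norm _)); first by rewrite -cz.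
  by rewrite -cz (cone_scale ri c0 cf).2 cz mul0r.
have cp : 0 < c by rewrite lt_neqAle eq_sym cn0.
apply/eqP; rewrite eq_le functional_modulus_scale_ge// andbT.
have ci : 0 < c^-1 by rewrite invr_gt0.
have := functional_modulus_scale_ge ci ccf.
rewrite (_ : (fun t => c^-1 * (c * f t)) = f); last by apply/funext => t; rewrite mulKf.
by rewrite mulrC ler_pdivrMr// mulrC.
Qed.

Lemma functional_modulus_dominated : dominated cone cone_norm N.
Proof.
split.
- exact: functional_modulus_add.
- by move=> c f; exact: functional_modulus_scale.
- exact: functional_modulus_ge0.
- exact: functional_modulus_le_norm.
Qed.

Lemma functional_modulus_mono f g : cone f -> cone g ->
  (\forall t \ae mu01, f t <= g t) -> N f <= N g.
Proof.
move=> cf cg fg; apply: functional_modulus_le => // z zf.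
by apply: functional_modulus_ub => //; apply: filterS2 zf fg => t; exact: le_trans.
Qed.

(** The elements a with this property form a closed convex set: majorants can be
    averaged because N is additive, and a limit is majorized by adding the
    modulus of a small difference.  The rotated slice lies in it since |z|
    majorizes theta z when |theta| = 1. *)
Lemma closed_aconv_majorant (eps : R) a : closed_aconv (slice phi eps) a ->
  forall eta : R, 0 < eta -> exists w, [/\ cone w, bounded_by w a,
    cone_norm w <= 1 + eta & 1 - eps - eta < N w].
Proof.
move=> ha; pose C : set X := [set a | forall eta : R, 0 < eta ->
  exists w, [/\ cone w, bounded_by w a, cone_norm w <= 1 + eta & 1 - eps - eta < N w]].
suff : closed_aconv (slice phi eps) `<=` C by move=> /(_ _ ha).
apply: smallest_sub; first split.
- move=> b Cb eta eta0.
  have eta2 : 0 < eta / 2 by rewrite divr_gt0.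
  have [b' [Cb' /ball_vnorm bb']] : C `&` ball b (emb (eta / 2)) !=set0.
    by apply: Cb; apply: nbhsx_ballx; rewrite -(emb0 (R := R)) ltr_emb.
  have [w [cw b'w wle Nw]] := Cb' _ eta2.
  have [cab normab] := absf_cone ri (b - b').
  have [cs norms] := cone_add ri cw cab.
  exists (w \+ absf (b - b')); split => //.
  + have h := reprD ri (repr_self fn b') (repr_self fn (b - b')).
    rewrite [b' + _]addrC subrK in h.
    apply: filterS2 h b'w => t -> h'.
    by apply: (le_trans (modulusD _ _)); exact: lerD.
  + rewrite normab in norms; lra.
  + rewrite functional_modulus_add//; have := functional_modulus_ge0 cab; lra.
- move=> b1 b2 l; rewrite !inE => C1 C2 eta eta0.
  have [w1 [cw1 bw1 nw1 Nw1]] := C1 _ eta0.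
  have [w2 [cw2 bw2 nw2 Nw2]] := C2 _ eta0.
  pose r := modulus (l%:num : K).
  have lE : l%:num = emb r by rewrite -norm_modulus ger0_norm.
  have r0 : 0 <= r by exact: modulus_ge0.
  have r1 : r <= 1 by rewrite -(ler_emb (k := k)) -lE emb1.
  have r1' : 0 <= 1 - r by rewrite subr_ge0.
  have [c1 n1] := cone_scale ri r0 cw1.
  have [c2 n2] := cone_scale ri r1' cw2.
  have [c12 n12] := cone_add ri c1 c2.
  exists ((fun t => r * w1 t) \+ (fun t => (1 - r) * w2 t)); split => //.
  + have h := reprD ri (reprZ ri (emb r) (repr_self fn b1)) (reprZ ri (emb (1 - r)) (repr_self fn b2)).
    have hE : emb r *: b1 + emb (1 - r) *: b2 = conv l (b1 : convex_lmodType X) b2.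
      by rewrite embD embN emb1 -lE.
    rewrite hE in h.
    have : \forall t \ae mu01, modulus (emb r * fn b1 t + emb (1 - r) * fn b2 t) <= r * w1 t + (1 - r) * w2 t.
      apply: filterS2 bw1 bw2 => t h1 h2.
      apply: (le_trans (modulusD _ _)); rewrite !modulusM !modulus_emb !ger0_norm//.
      by rewrite lerD// ler_wpM2l.
    by apply: filterS2 h => t ->.
  + apply: (le_trans n12); rewrite n1 n2.
    have h1 : r * cone_norm w1 <= r * (1 + eta) by rewrite ler_wpM2l.
    have h2 : (1 - r) * cone_norm w2 <= (1 - r) * (1 + eta) by rewrite ler_wpM2l.
    lra.
  + rewrite functional_modulus_add// !functional_modulus_scale//.
    have [->|rn0] := eqVneq r 0; first by rewrite mul0r add0r subr0 mul1r.
    have h1 : r * (1 - eps - eta) < r * N w1 by rewrite ltr_pM2l// lt_neqAle eq_sym rn0.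
    have h2 : (1 - r) * (1 - eps - eta) <= (1 - r) * N w2 by rewrite ler_wpM2l// ltW.
    lra.
- move=> _ [theta [z [z1 zphi] [th1 ->]]] eta eta0.
  have [cz nz] := absf_cone ri z.
  exists (absf z); split => //.
  + apply: filterS (reprZ ri theta (repr_self fn z)) => t ->.
    by rewrite modulusM th1 mul1r.
  + rewrite nz; lra.
  + have := functional_modulus_ub cz (bounded_by_absf z); lra.
Qed.

End Modulus.

Lemma lush_function_space : lush X -> lush_cone cone cone_norm.
Proof.
move=> lushX u y eps cu cy u1 y1 eps0.
have eps2 : 0 < eps / 2 by rewrite divr_gt0.
have eps4 : 0 < eps / 4 by rewrite divr_gt0.
have ru := classP cu; have ry := classP cy.
have y0 t : 0 <= y t by case: cy.
have [phi phiS [[_ phiu]]] := lushX (class u) (class y) u1 y1 _ eps2.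
move=> /ereal_inf_lt[_ [a /(closed_aconv_majorant phiS)/(_ _ eps4)[w [cw aw nw Nw]] <-]].
rewrite lte_fin => ya.
have [cb nb] := absf_cone ri (class y - a).
have [cs ns] := cone_add ri cw cb.
set w1 := w \+ absf (class y - a) in cs ns.
pose w2 t := Num.max (w1 t) (y t).
have w1y : \forall t \ae mu01, y t <= w1 t.
  have h := reprD ri (repr_self fn a) (repr_self fn (class y - a)).
  rewrite [a + _]addrC subrK in h.
  have : \forall t \ae mu01, emb (y t) = fn a t + fn (class y - a) t.
    by apply: filterS2 ry h => t ->.
  move=> {}h; apply: filterS2 h aw => t h' at_.
  rewrite -(modulus_emb_ge0 (k := k) (y0 t)) h'.
  by apply: (le_trans (modulusD _ _)); rewrite /w1 /= lerD.
have mw2 : measurable_fun setT w2.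
  by apply: measurable_maxr; [case: cs|case: cy].
have rw2 : repr (class w1) (fun t => emb (w2 t)).
  apply: filterS2 w1y (classP cs) => t yt ->.
  by rewrite /w2 max_l.
have cw2 : cone w2.
  split => //; last by exists (class w1).
  by move=> t; rewrite le_max y0 orbT.
have nw2 : cone_norm w2 = cone_norm w1 by rewrite (cone_normE ri rw2).
exists (functional_modulus phi), w2; split => //.
- exact: functional_modulus_dominated.
- have h : bounded_by u (class u).
    apply: filterS ru => t ->; rewrite modulus_emb_ge0//; by case: cu.
  have := functional_modulus_ub phiS cu h; lra.
- by move=> t; rewrite le_max lexx orbT.
- split; first by rewrite nw2; move: ns; rewrite nb; lra.
  have : functional_modulus phi w <= functional_modulus phi w2.
    apply: functional_modulus_mono => //; apply: aeW => t.
    rewrite le_max; apply/orP; left; rewrite /w1 /= lerDl; exact: modulus_ge0.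
  lra.
Qed.

End LushFunctionSpace.

(** * Separability and sets of small measure *)

Section SmallSets.
Context {R : realType} {k : scalar_kind}.
Local Notation K := (scalars_of R k).
Local Notation T := (measurableTypeR R).
Local Notation intble f := (mu01.-integrable [set: T] (EFin \o f)).

Lemma integral_small_set (f : T -> R) (e : R) : intble f -> (forall t, 0 <= f t) -> 0 < e ->
  exists2 d : R, 0 < d & forall A : set T, measurable A -> meas A < d ->
    \int[mu01]_t (f t * \1_A t) < e.
Proof.
move=> fi f0 e0; have [d [d0 H]] := integral_normr_continuous fi e0.
exists d => // A mA Ad.
have := H A mA; rewrite -(measE mA) lte_fin => /(_ Ad).
congr (_ < _); rewrite Rintegral_mkcond; apply: eq_Rintegral => t _.
rewrite /patch indicE; case: ifP => _; last by rewrite mulr0.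
by rewrite mulr1 ger0_norm.
Qed.

Implicit Types (F G : T -> K).

Lemma kintegralD F G : kintegrable F -> kintegrable G ->
  kintegral (fun t => F t + G t) = kintegral F + kintegral G.
Proof.
move=> [rF iF] [rG iG]; apply: scalar_eq.
  rewrite reD /kintegral.
  case: k F G rF iF rG iG => /= F G rF iF rG iG; rewrite -RintegralD//=.
  by apply: eq_Rintegral => t _; case: (F t) (G t) => ? ? [].
rewrite imD /kintegral.
case: k F G rF iF rG iG => /= F G rF iF rG iG; first by rewrite addr0.
by rewrite -RintegralD//=; apply: eq_Rintegral => t _; case: (F t) (G t) => ? ? [].
Qed.

Lemma re_kintegral F : re (kintegral F) = \int[mu01]_t re (F t).
Proof. by rewrite /kintegral; case: k F. Qed.

Lemma im_kintegral F : im (kintegral F) = \int[mu01]_t im (F t).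
Proof.
rewrite /kintegral; case: k F => //= F.
by rewrite /Rintegral integral0.
Qed.

Lemma kintegralZ (r : R) F : kintegrable F ->
  kintegral (fun t => emb r * F t) = emb r * kintegral F.
Proof.
move=> [rF iF]; apply: scalar_eq.
  rewrite reM re_emb im_emb mul0r subr0 !re_kintegral -RintegralZl//.
  by apply: eq_Rintegral => t _; rewrite reM re_emb im_emb mul0r subr0.
rewrite imM re_emb im_emb mul0r addr0 !im_kintegral -RintegralZl//.
by apply: eq_Rintegral => t _; rewrite imM re_emb im_emb mul0r addr0.
Qed.

Lemma ae_eq_kintegral F G : kmeasurable F -> kmeasurable G -> ae_equal F G ->
  kintegral F = kintegral G.
Proof.
move=> [rF iF] [rG iG] FG; rewrite /kintegral /Rintegral.
congr (of_re_im _ (fine _) (fine _)); apply: ae_eq_integral => //;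
  try exact/measurable_EFinP; by apply: filterS FG => t ->.
Qed.

Lemma modulus_kintegral F : kintegrable F ->
  modulus (kintegral F) <= 2 * \int[mu01]_t modulus (F t).
Proof.
move=> Fi; have Fm := kintegrable_measurable Fi.
have mi := (kintegrableP Fm).1 Fi; case: Fi => rF iF.
apply: (le_trans (modulus_le_re_im _)); rewrite re_kintegral im_kintegral mulr2n mulrDl !mul1r.
apply: lerD.
  apply: (le_trans (le_normr_Rintegral measurableT rF)).
  apply: le_Rintegral => //; first exact: (integrable_norm rF).
  by move=> t _; exact: norm_re.
apply: (le_trans (le_normr_Rintegral measurableT iF)).
apply: le_Rintegral => //; first exact: (integrable_norm iF).
by move=> t _; exact: norm_im.
Qed.

Context {X : completeNormedModType K} (fn : X -> T -> K).
Hypothesis ri : ri_space fn.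
Local Notation repr := (represents fn).
Local Notation cone := (cone fn).
Local Notation cone_norm := (cone_norm fn).
Local Notation absf := (absf fn).
Local Notation class := (class fn).

Lemma cone_norm_ae (f g : T -> R) : cone f -> cone g ->
  (\forall t \ae mu01, f t <= g t) -> cone_norm f <= cone_norm g.
Proof.
move=> cf cg fg; rewrite (cone_normE ri (classP cf)) (cone_normE ri (classP cg)).
apply: (vnorm_le_ae ri (classP cf) (classP cg)).
by apply: filterS fg => t; rewrite !modulus_emb_ge0//; [case: cg|case: cf].
Qed.

Lemma cone_indic (A : set T) : measurable A -> cone (\1_A).
Proof.
move=> mA; have [c1 _] := cone_one ri.
by have [] := cone_solid ri c1 (measurable_indic mA) (indic01 A).
Qed.

Definition restricted (F : set T) (x : X) (t : T) : R := absf x t * \1_F t.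

Lemma cone_restricted (F : set T) (x : X) : measurable F ->
  cone (restricted F x) /\ cone_norm (restricted F x) <= vnorm x.
Proof.
move=> mF; have [cx <-] := absf_cone ri x.
apply: (cone_solid ri cx).
  by apply: measurable_funM; [case: cx|exact: measurable_indic].
move=> t; have /andP[h1 h2] := indic01 (R := R) F t.
by rewrite /restricted mulr_ge0 ?modulus_ge0//= ler_piMr// modulus_ge0.
Qed.

(** Passing from the chosen representative of the class of 1_A to 1_A itself,
    and from the unit ball to all of X by homogeneity. *)
Lemma pairing_indic_le (g : T -> K) (A : set T) : measurable A ->
  kothe_dual fn g -> (kothe_dual_norm fn g <= 1)%E ->
  kintegrable (fun t => emb (\1_A t) * g t) /\
  modulus (kintegral (fun t => emb (\1_A t) * g t)) <= cone_norm (\1_A).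
Proof.
move=> mA [mg gi] g1; have cA := cone_indic mA.
set x := class (\1_A).
have rx : repr x (fun t => emb (\1_A t)) := classP cA.
have mAg : kmeasurable (fun t => emb (\1_A t) * g t).
  by apply: kmeasurableM => //; apply: kmeasurable_emb; exact: measurable_indic.
have mxg (y : X) : kmeasurable (fun t => fn y t * g t).
  by apply: kmeasurableM => //; exact: (fn_measurable ri).
have eqI : kintegral (fun t => fn x t * g t) = kintegral (fun t => emb (\1_A t) * g t).
  by apply: ae_eq_kintegral => //; apply: filterS rx => t ->.
have xgi := gi x I.
split.
  apply/(kintegrableP mAg); have /(kintegrableP (mxg x)) := xgi.
  have := measurable_modulus mAg; have := measurable_modulus (mxg x).
  move=> m1 m2 /integrableP[_ h]; apply/integrableP; split; first exact/measurable_EFinP.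
  move: h; congr (_ < _)%E; apply: ae_eq_integral => //.
  - by apply/measurable_EFinP; apply: measurableT_comp.
  - by apply/measurable_EFinP; apply: measurableT_comp.
  - by apply: filterS rx => t h _ /=; rewrite h.
rewrite -eqI.
have [x0|x0] := eqVneq (vnorm x) 0.
  rewrite (cone_normE ri rx) x0 (vnorm_eq0 x0).
  rewrite (@ae_eq_kintegral _ (fun t => emb 0 * g t)).
  - have := @kintegralZ 0 _ xgi; rewrite emb0 mul0r => h.
    rewrite (_ : (fun t => 0 * g t) = (fun t => 0 * (fn x t * g t))) ?h ?modulus0//.
    by apply/funext => t; rewrite !mul0r.
  - exact: mxg.
  - by apply: kmeasurableM => //; exact: kmeasurable_cst.
  - by apply: filterS (repr0 ri) => t ->; rewrite emb0.
have xp : 0 < vnorm x by rewrite lt_neqAle eq_sym x0 vnorm_ge0.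
pose u := emb (vnorm x)^-1 *: x.
have u1 : vnorm u = 1.
  by rewrite vnormZ modulus_emb ger0_norm ?invr_ge0 ?vnorm_ge0// mulVf.
have : ((modulus (kintegral (fun t => fn u t * g t)))%:E <= 1%:E)%E.
  apply: le_trans g1; apply: ereal_sup_ubound; exists u => //; split => //.
  by rewrite u1.
have -> : kintegral (fun t => fn u t * g t) = emb (vnorm x)^-1 * kintegral (fun t => fn x t * g t).
  rewrite -kintegralZ//; apply: ae_eq_kintegral => //.
    by apply: kmeasurableM => //; exact: kmeasurable_cst.
  by apply: filterS (reprZ ri (emb (vnorm x)^-1) (repr_self fn x)) => t ->; rewrite mulrA.
rewrite lee_fin modulusM modulus_emb ger0_norm ?invr_ge0 ?vnorm_ge0//.
by rewrite mulrC ler_pdivrMr// mul1r (cone_normE ri rx).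
Qed.

(** The norm of 1_(V m) is at least c, so it is tested by some g in the Köthe
    dual; the integral of |g| over V m' tends to 0, hence g still gives a large
    value to V m minus V m'. *)
Lemma cone_norm_indic_setD (V : nat -> set T) (c : R) : 0 < c ->
  (forall m, measurable (V m)) -> (forall d : R, 0 < d -> exists m0, forall m, (m0 <= m)%N -> meas (V m) < d) ->
  (forall m, c <= cone_norm (\1_(V m))) ->
  forall m, exists m', (m < m')%N /\ c / 2 <= cone_norm (\1_(V m `\` V m')).
Proof.
move=> c0 mV V0 Vc m.
have cm := cone_indic (mV m).
have : ((3 / 4 * c)%:E < (vnorm (class (\1_(V m))))%:E)%E.
  rewrite lte_fin -(cone_normE ri (classP cm)) (lt_le_trans _ (Vc m))//; lra.
rewrite (ri_norming ri) => /ereal_sup_gt[_ [g [gd g1] <-]]; rewrite lte_fin => gc.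
have mg : kmeasurable g by case: gd.
have gi : kintegrable g.
  have [+ _] := pairing_indic_le measurableT gd g1.
  congr kintegrable; apply/funext => t.
  by rewrite indicE in_setT emb1 mul1r.
have gmi := (kintegrableP mg).1 gi.
have c8 : 0 < c / 8 by rewrite divr_gt0.
have [d d0 Hd] := integral_small_set gmi (fun t => modulus_ge0 (g t)) c8.
have [m0 Hm0] := V0 _ d0.
pose m' := maxn m0 m.+1; exists m'; split; first by rewrite leq_max leqnn orbT.
have Vd : meas (V m') < d by apply: Hm0; rewrite leq_maxl.
have mD : measurable (V m `\` V m') by exact: measurableD.
have mI : measurable (V m `&` V m') by exact: measurableI.
have [iD leD] := pairing_indic_le mD gd g1.
have [iI leI] := pairing_indic_le mI gd g1.
apply: le_trans leD.
have eqI : kintegral (fun t => fn (class (\1_(V m))) t * g t) =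
  kintegral (fun t => emb (\1_(V m `\` V m') t) * g t) + kintegral (fun t => emb (\1_(V m `&` V m') t) * g t).
  rewrite -kintegralD//; apply: ae_eq_kintegral.
  - by apply: kmeasurableM => //; exact: (fn_measurable ri).
  - apply: kmeasurableD; apply: kmeasurableM => //; apply: kmeasurable_emb; exact: measurable_indic.
  - apply: filterS (classP cm) => t ->; rewrite -mulrDl -embD.
    rewrite -{1}(setUIDK (V m) (V m')) indicD; last by move=> s [_ h] [].
    by rewrite [in RHS]addrC.
have small : modulus (kintegral (fun t => emb (\1_(V m `&` V m') t) * g t)) <= c / 4.
  apply: (le_trans (modulus_kintegral iI)).
  have := Hd _ mI (le_lt_trans (meas_le mI (mV m') (@subIsetr _ _ _)) Vd).
  have -> : \int[mu01]_t (modulus (g t) * \1_(V m `&` V m') t) =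
      \int[mu01]_t modulus (emb (\1_(V m `&` V m') t) * g t).
    apply: eq_Rintegral => t _; rewrite modulusM modulus_emb mulrC ger0_norm//.
  lra.
move: gc; rewrite eqI => gc.
have := modulusD (kintegral (fun t => emb (\1_(V m `\` V m') t) * g t)) (kintegral (fun t => emb (\1_(V m `&` V m') t) * g t)).
lra.
Qed.

(** Diagonal argument.  Enumerate a countable dense set D injectively by e, and
    let U be the union of the F j over the indices j = e d such that d is small
    on F j.
    Then the indicator of U differs from every d in D on F (e d): it is 1 there
    when d is small, and 0 when d is not. *)
Lemma separable_not_spread (F : nat -> set T) (c : R) : 0 < c ->
  (forall j, measurable (F j)) -> (forall i j s, F i s -> F j s -> i = j) ->
  (forall j, c <= cone_norm (\1_(F j))) -> ~ separable X.
Proof.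
move=> c0 mF tF Fc [D /countable_injP[e einj] Ddense].
pose S := [set j | exists2 d, D d & e d = j /\ cone_norm (restricted (F j) d) < c / 2].
pose U := \bigcup_(j in S) F j.
have mU : measurable U by apply: bigcup_measurable.
have cU := cone_indic mU.
have c20 : 0 < c / 2 by rewrite divr_gt0.
have cc : (0 : K) < emb (c / 2) by rewrite -(emb0 (R := R)) ltr_emb.
have [|d [/ball_vnorm vd Dd]] := Ddense (ball (class (\1_U)) (emb (c / 2))) _ (ball_open _ _).
  by exists (class (\1_U)); exact: ballxx.
set j := e d.
have [cd _] := cone_restricted d (mF j).
have [cv nv] := absf_cone ri (class (\1_U) - d).
have rv := reprB ri (classP cU) (repr_self fn d).
have [jS|njS] := pselect (S j).
  have [d' Dd' [ed' small]] := jS.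
  have dd : d' = d by apply: einj => //; rewrite inE.
  rewrite dd in small.
  have [cs ns] := cone_add ri cv cd.
  have : cone_norm (\1_(F j)) <= cone_norm (absf (class (\1_U) - d) \+ restricted (F j) d).
    apply: cone_norm_ae => //; first exact: cone_indic.
    apply: filterS rv => t h /=; rewrite /absf h /restricted.
    have [Fjt|Fjt] := pselect (F j t); last first.
      by rewrite !indicE (memNset Fjt) mulr0 addr0 modulus_ge0.
    rewrite !indicE (mem_set Fjt) mulr1 mem_set; last by exists j.
    rewrite emb1 -[leLHS](modulus_emb_ge0 (k := k) (f := cst 1) (t := 0))//= emb1.
    by rewrite -[X in modulus X](subrK (fn d t)); exact: modulusD.
  have := Fc j; rewrite nv in ns; lra.
have big : c / 2 <= cone_norm (restricted (F j) d).
  by rewrite leNgt; apply/negP => h; apply: njS; exists d.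
have : cone_norm (restricted (F j) d) <= cone_norm (absf (class (\1_U) - d)).
  apply: cone_norm_ae => //.
  apply: filterS rv => t h; rewrite /absf h /restricted.
  have [Fjt|Fjt] := pselect (F j t); last by rewrite [in leLHS]indicE (memNset Fjt) mulr0 modulus_ge0.
  rewrite [in leLHS]indicE (mem_set Fjt) mulr1 indicE memNset; last first.
    by move=> [i Si /(tF _ _ _ Fjt) ji]; apply: njS; rewrite ji.
  by rewrite emb0 sub0r modulusN.
rewrite nv; lra.
Qed.

(** Otherwise there are sets A n of measure less than 2^-(n+1) and norm at least
    c.  Their tails V m decrease, have measure tending to 0 and norm at least
    c, and so do contain infinitely many disjoint differences of norm at least
    c / 2. *)
Lemma separable_abs_cont : separable X -> forall c : R, 0 < c ->
  exists2 s : R, 0 < s & forall A : set T, measurable A -> meas A < s -> cone_norm (\1_A) < c.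
Proof.
move=> sepX c c0; apply: contrapT => /forall2NP H.
have H' n : exists A : set T, [/\ measurable A, meas A < (2 ^ n.+1)%:R^-1 & c <= cone_norm (\1_A)].
  have [|/existsNP[A /not_implyP[mA /not_implyP[An /negP]]]] := H ((2 ^ n.+1)%:R^-1).
    by rewrite invr_gt0 ltr0n expn_gt0.
  by rewrite -leNgt => cA; exists A.
have [A HA] := choice H'.
pose V m := \bigcup_i A (m + i)%N.
have mA n : measurable (A n) by case: (HA n).
have mV m : measurable (V m) by exact: bigcup_measurable.
have Vdec m n : (m <= n)%N -> V n `<=` V m.
  by move=> mn s [i _ Ai]; exists (n + i - m)%N => //; rewrite subnKC// (leq_trans mn)// leq_addr.
have Vsmall m : meas (V m) <= (2 ^ m)%:R^-1.
  rewrite -lee_fin measE//.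
  apply: (@le_trans _ _ (\sum_(0 <= i <oo) mu01 (A (m + i)%N))%E).
    by apply: measure_sigma_subadditive => //; exact: mV.
  apply: le_trans (epsilon_trick0 xpredT _); last by rewrite invr_ge0.
  apply: lee_nneseries => // i _; rewrite -measE// lee_fin.
  have [_ /ltW /le_trans + _] := HA (m + i)%N; apply.
  by rewrite -invfM -natrM -expnD addnS.
have V0 (d : R) : 0 < d -> exists m0, forall m, (m0 <= m)%N -> meas (V m) < d.
  move=> d0; exists (Num.truncn d^-1).+1 => m m0m; apply: (le_lt_trans (Vsmall m)).
  rewrite invf_plt ?posrE ?ltr0n ?expn_gt0//.
  apply: (lt_le_trans (truncnS_gt _)); rewrite ler_nat (leq_trans m0m)//.
  exact/ltnW/ltn_expl.
have Vc m : c <= cone_norm (\1_(V m)).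
  have [_ _ cA] := HA m; apply: (le_trans cA).
  apply: cone_norm_ae; [exact: cone_indic|exact: cone_indic|].
  by apply: aeW => t; apply: le_indic => s As; exists 0%N => //; rewrite addn0.
have [nxt Hnxt] := choice (cone_norm_indic_setD c0 mV V0 Vc).
pose ms j := iter j nxt 0%N.
have ms_lt i j : (i < j)%N -> (ms i.+1 <= ms j)%N.
  elim: j => // j IH; rewrite ltnS leq_eqVlt => /predU1P[->//|/IH/leq_trans]; apply.
  by apply: ltnW; have [] := Hnxt (ms j).
have c20 : 0 < c / 2 by rewrite divr_gt0.
pose F j := V (ms j) `\` V (ms j.+1).
have mF j : measurable (F j) by exact: (measurableD (mV _) (mV _)).
have F_lt i j s : (i < j)%N -> F i s -> ~ F j s.
  by move=> ij [_ nV] [Vj _]; apply: nV; exact: (Vdec _ _ (ms_lt _ _ ij) _ Vj).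
have tF i j s : F i s -> F j s -> i = j.
  move=> Fi Fj; have [ij|ji|//] := ltngtP i j.
    by case: (F_lt _ _ _ ij Fi Fj).
  by case: (F_lt _ _ _ ji Fj Fi).
have Fc j : c / 2 <= cone_norm (\1_(F j)).
  by have [_ h] := Hnxt (ms j); exact: h.
exact: (separable_not_spread c20 mF tF Fc sepX).
Qed.

End SmallSets.

(** * From indicators to integrable functions *)

Section IndicatorsToIntegrable.
Context {R : realType}.
Local Notation T := (measurableTypeR R).
Implicit Types (f g : T -> R) (A : set T).
Local Notation intble f := (mu01.-integrable [set: T] (EFin \o f)).

Section Cone.
Variables (E : set (T -> R)) (rho : (T -> R) -> R).
Hypothesis snE : symmetric_norm E rho.
Hypothesis rho_indic : forall A, measurable A -> rho (\1_A) <= meas A.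

(** A function g with values in [0, 1] is half the indicator of {g > 1/2} plus
    half of another function h with values in [0, 1].  So the supremum r of
    rho g - int g over all such functions satisfies r <= r / 2. *)
Lemma rho_le_integral01 f : measurable_fun setT f -> (forall t, 0 <= f t <= 1) ->
  rho f <= \int[mu01]_t f t.
Proof.
pose F := [set f : T -> R | measurable_fun setT f /\ forall t, 0 <= f t <= 1].
pose L f := rho f - \int[mu01]_t f t.
have EF g : F g -> E g by move=> [mg]; exact: (E_bounded snE).
have supF : has_sup (L @` F).
  split; first by exists (L (cst 0)), (cst 0) => //; split => // t; rewrite lexx ler01.
  exists 1 => _ [g Fg <-]; rewrite /L lerBlDr.
  have I0 : 0 <= \int[mu01]_t g t by apply: Rintegral_ge0 => t _; case: Fg => _ /(_ t)/andP[].
  have := (sn_solid snE (sn_one snE).1 Fg.1 Fg.2).2; have := (sn_one snE).2; lra.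
have halve g : F g -> L g <= sup (L @` F) / 2.
  move=> Fg; have [mg g01] := Fg.
  pose A := ~` [set t | g t <= 1 / 2].
  have mA : measurable A by apply: measurableC; exact: measurable_sublevel.
  pose h t := 2 * g t - \1_A t.
  have Fh : F h.
    split => [|t].
      apply: measurable_funB; last exact: measurable_indic.
      exact: measurable_funM.
    have gt01 := g01 t; rewrite /h; have [gt|gt] := leP (g t) (1 / 2).
      by rewrite indicE memNset /=; [lra|apply].
    rewrite indicE mem_set//=; first by lra.
    by move=> /=; apply/negP; rewrite -ltNge.
  have Lh : L h <= sup (L @` F) by apply: ub_le_sup; [case: supF|exists h].
  have half0 : 0 <= 1 / 2 :> R by rewrite divr_ge0.
  have EA := E_indic snE mA.
  have [EA2 rA2] := sn_scale snE half0 EA.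
  have [Eh2 rh2] := sn_scale snE half0 (EF _ Fh).
  have [_ rs] := sn_add snE EA2 Eh2.
  have gE : g = (fun t => 1 / 2 * \1_A t) \+ (fun t => 1 / 2 * h t).
    by apply/funext => t /=; rewrite /h; lra.
  have Ih := (sn_L1 snE (EF _ Fh)).1.
  have IA := integrable_mu01_indic mA.
  have : \int[mu01]_t g t = 1 / 2 * meas A + 1 / 2 * \int[mu01]_t h t.
    rewrite {1}gE RintegralD//; [|exact: (sn_L1 snE EA2).1|exact: (sn_L1 snE Eh2).1].
    by rewrite !RintegralZl// Rintegral_indic.
  rewrite -gE in rs; have := rho_indic mA; move: Lh; rewrite /L; lra.
have sup_le : sup (L @` F) <= sup (L @` F) / 2.
  by apply: ge_sup => [|_ [g Fg <-]]; [case: supF|exact: halve].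
move=> mf f01; have Lf : L f <= sup (L @` F) by apply: ub_le_sup; [case: supF|exists f].
rewrite /L in Lf sup_le *; lra.
Qed.

Lemma rho_le_integral_bounded f (M : R) : measurable_fun setT f -> (forall t, 0 <= f t <= M) ->
  rho f <= \int[mu01]_t f t.
Proof.
move=> mf fM; pose M1 := M + 1.
have M0 : 0 <= M by have /andP[h1 h2] := fM 0; exact: le_trans h2.
have M10 : 0 < M1 by rewrite /M1 ltr_wpDl.
pose g t := M1^-1 * f t.
have mg : measurable_fun setT g by exact: measurable_funM.
have g01 t : 0 <= g t <= 1.
  have /andP[h1 h2] := fM t; rewrite /g mulr_ge0 ?invr_ge0 ?(ltW M10)//=.
  by rewrite mulrC ler_pdivrMr// mul1r /M1 (le_trans h2)// lerDl.
have Eg := E_bounded snE mg g01.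
have fE : f = (fun t => M1 * g t) by apply/funext => t; rewrite mulVKf// gt_eqF.
rewrite fE (sn_scale snE (ltW M10) Eg).2 RintegralZl//; last exact: (sn_L1 snE Eg).1.
by rewrite ler_pM2l// rho_le_integral01.
Qed.

End Cone.

(** The integrand is at most g on {g > n}, a set of measure at most
    (int g) / n, and vanishes elsewhere. *)
Lemma integral_truncation_cvg g : intble g -> (forall t, 0 <= g t) ->
  forall e : R, 0 < e -> exists N, forall n, (N <= n)%N ->
  \int[mu01]_t (g t - Num.min (g t) n%:R) < e.
Proof.
move=> gi g0 e e0.
have mg : measurable_fun setT g by have /measurable_int/measurable_EFinP := gi.
have [d d0 Hd] := integral_small_set gi g0 e0.
set I := \int[mu01]_t g t.
have I0 : 0 <= I by apply: Rintegral_ge0.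
exists (Num.truncn (I / d)).+1 => n Nn.
have nI : I / d < n%:R by apply: (lt_le_trans (truncnS_gt _)); rewrite ler_nat.
have n0 : 0 < n%:R :> R by apply: le_lt_trans nI; rewrite divr_ge0// ltW.
pose A := ~` [set t | g t <= n%:R].
have mA : measurable A by apply: measurableC; exact: measurable_sublevel.
have Ad : meas A < d.
  apply: (le_lt_trans (markov_integral gi g0 n0)).
  by rewrite ltr_pdivrMr// -ltr_pdivrMl// mulrC.
apply: le_lt_trans (Hd _ mA Ad).
have bnd t : 0 <= g t - Num.min (g t) n%:R <= g t * \1_A t.
  have [gt|gt] := leP (g t) n%:R.
    by rewrite indicE memNset ?subrr ?mulr0 ?lexx// => /= /(_ gt).
  rewrite indicE mem_set/=; last by apply/negP; rewrite -ltNge.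
  by rewrite mulr1 subr_ge0 (ltW gt)/= gerBl ltW.
have mAg : measurable_fun setT (fun t => g t * \1_A t).
  by apply: measurable_funM => //; exact: measurable_indic.
have iAg : intble (fun t => g t * \1_A t).
  apply: le_integrable gi => //; first exact/measurable_EFinP.
  move=> t _ /=; have /andP[i0 i1] := indic01 (R := R) A t.
  by rewrite lee_fin !ger0_norm ?mulr_ge0// ler_piMr.
apply: le_Rintegral => //.
  apply: le_integrable iAg => //.
    by apply/measurable_EFinP; apply: measurable_funB => //; apply: measurable_minr.
  move=> t _ /=; have /andP[h1 h2] := bnd t.
  by rewrite lee_fin !ger0_norm//; exact: le_trans h2.
by move=> t _; case/andP: (bnd t).
Qed.

End IndicatorsToIntegrable.

Section EqualsL1.
Context {R : realType} {k : scalar_kind}.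
Local Notation K := (scalars_of R k).
Local Notation T := (measurableTypeR R).
Local Notation intble f := (mu01.-integrable [set: T] (EFin \o f)).
Context {X : completeNormedModType K} (fn : X -> T -> K).
Hypothesis ri : ri_space fn.
Local Notation repr := (represents fn).
Local Notation cone := (cone fn).
Local Notation cone_norm := (cone_norm fn).
Local Notation absf := (absf fn).
Local Notation class := (class fn).
Hypothesis bounded_norm : forall (f : T -> R) (M : R), measurable_fun setT f ->
  (forall t, 0 <= f t <= M) -> cone f /\ cone_norm f <= \int[mu01]_t f t.

Lemma complete_cauchy_seq (v : nat -> X) :
  (forall r : R, 0 < r -> exists N, forall n, (N <= n)%N -> vnorm (v N - v n) < r) ->
  exists l, forall r : R, 0 < r -> exists N, forall n, (N <= n)%N -> vnorm (l - v n) < r.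
Proof.
move=> H.
have : cauchy (v @ \oo).
  apply: cauchy_exP => e e0.
  have eE : e = emb (modulus e) by rewrite -norm_modulus gtr0_norm.
  have [N HN] : exists N, forall n, (N <= n)%N -> vnorm (v N - v n) < modulus e.
    by apply: H; rewrite -(ltr_emb (k := k)) -eE emb0.
  exists (v N); exists N => // n /= Nn; rewrite eE; apply/ball_vnorm; exact: HN.
move=> /cauchy_cvg vc; exists (lim (v @ \oo)) => r r0.
have er : (0 : K) < emb r by rewrite -(emb0 (R := R)) ltr_emb.
have /cvgrPdist_lt/(_ _ er)[N _ HN] := vc.
by exists N => n Nn; have := HN n Nn; rewrite /= norm_vnorm ltr_emb.
Qed.

(** The truncations of g at level n form a Cauchy sequence in X because the norm
    of their differences is at most that in L_1.  Its limit in X is also its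
    limit in L_1, that is, g. *)
Lemma integrable_cone (g : T -> R) : intble g -> (forall t, 0 <= g t) ->
  cone g /\ cone_norm g <= \int[mu01]_t g t.
Proof.
move=> gi g0.
have mg : measurable_fun setT g by have /measurable_int/measurable_EFinP := gi.
pose h (n : nat) t := Num.min (g t) n%:R.
have mh n : measurable_fun setT (h n) by exact: measurable_minr.
have h0 n t : 0 <= h n t by rewrite /h le_min g0 ler0n.
have hg n t : h n t <= g t by rewrite /h ge_min lexx.
have hn n t : 0 <= h n t <= n%:R by rewrite h0/= /h ge_min lexx orbT.
have hmono m n t : (m <= n)%N -> h m t <= h n t.
  by move=> mn; rewrite /h le_min !ge_min lexx ler_nat mn orbT.
have ch n : cone (h n) by case: (bounded_norm (mh n) (hn n)).
pose v n := class (h n).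
have rv n : repr (v n) (fun t => emb (h n t)) by exact: classP.
have hi n : intble (h n) by exact: (cone_L1 ri (ch n)).1.
have gap n : intble (fun t => g t - h n t) by exact: (integrableB measurableT gi (hi n)).
have tail := integral_truncation_cvg gi g0.
have vdist m n : (m <= n)%N -> vnorm (v m - v n) <= \int[mu01]_t (g t - h m t).
  move=> mn; rewrite -vnormN opprB.
  have b t : 0 <= h n t - h m t <= n%:R.
    by rewrite subr_ge0 hmono//= lerBlDr; have /andP[_ /le_trans ->//] := hn n t; rewrite lerDl.
  have md : measurable_fun setT (fun t => h n t - h m t) by exact: measurable_funB.
  have [cd nd] := bounded_norm md b.
  have <- : cone_norm (fun t => h n t - h m t) = vnorm (v n - v m).
    apply: (cone_normE ri); apply: eq_repr (reprB ri (rv n) (rv m)) => t.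
    by rewrite embD embN.
  apply: (le_trans nd); apply: le_Rintegral => //; first exact: (cone_L1 ri cd).1.
  by move=> t _; rewrite lerD2r.
have [l Hl] : exists l, forall r : R, 0 < r -> exists N, forall n, (N <= n)%N -> vnorm (l - v n) < r.
  apply: complete_cauchy_seq => r r0; have [N HN] := tail _ r0.
  by exists N => n Nn; apply: (le_lt_trans (vdist _ _ Nn)); exact: HN.
have approx (r : R) : 0 < r -> exists n, vnorm (l - v n) < r /\ \int[mu01]_t (g t - h n t) < r.
  move=> r0; have [N1 H1] := Hl _ r0; have [N2 H2] := tail _ r0.
  by exists (maxn N1 N2); rewrite H1 ?H2// ?leq_maxl ?leq_maxr.
have mgk : kmeasurable (fun t => emb (g t) : K) by exact: kmeasurable_emb.
have mdiff : kmeasurable (fun t => fn l t + emb (- g t)).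
  apply: kmeasurableD; first exact: (fn_measurable ri).
  by apply: kmeasurable_emb; exact: measurable_funN.
have mhn n : kmeasurable (fun t => fn l t + emb (- h n t)).
  apply: kmeasurableD; first exact: (fn_measurable ri).
  by apply: kmeasurable_emb; exact: measurable_funN.
have rln n : repr (l - v n) (fun t => fn l t + emb (- h n t)).
  by apply: eq_repr (reprB ri (repr_self fn l) (rv n)) => t; rewrite embN.
have lg : repr l (fun t => emb (g t)).
  have pt n t : modulus (fn l t + emb (- g t)) <= modulus (fn l t + emb (- h n t)) + (g t - h n t).
    have -> : fn l t + emb (- g t) = (fn l t + emb (- h n t)) + emb (h n t - g t).
      by rewrite -addrA -embD addrA addNr add0r.
    apply: (le_trans (modulusD _ _)); rewrite lerD2l modulus_emb distrC ger0_norm//.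
    by rewrite subr_ge0.
  have int_diff : intble (fun t => modulus (fn l t + emb (- g t))).
    have [i1 _] := repr_int ri (rln 0%N) (mhn 0%N).
    have i2 := integrableD measurableT i1 (gap 0%N).
    apply: le_integrable i2 => //; first by apply/measurable_EFinP; exact: measurable_modulus.
    move=> t _ /=; rewrite lee_fin ger0_norm ?modulus_ge0//.
    by apply: (le_trans (pt 0%N t)); rewrite ler_norm.
  have I0 : \int[mu01]_t modulus (fn l t + emb (- g t)) <= 0.
    apply/ler_addgt0Pl => r r0; rewrite addr0.
    have r2 : 0 < r / 2 by rewrite divr_gt0.
    have [n [n1 n2]] := approx _ r2.
    have [i1 i1le] := repr_int ri (rln n) (mhn n).
    have : \int[mu01]_t modulus (fn l t + emb (- g t)) <=
      \int[mu01]_t (modulus (fn l t + emb (- h n t)) + (g t - h n t)).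
      apply: le_Rintegral => //; exact: (integrableD measurableT i1 (gap n)).
    by rewrite RintegralD//; lra.
  have I0' : (\int[mu01]_t `|(modulus (fn l t + emb (- g t)))%:E| = 0)%E.
    rewrite (eq_integral (fun t => (modulus (fn l t + emb (- g t)))%:E)); last first.
      by move=> t _; rewrite gee0_abs// lee_fin modulus_ge0.
    rewrite -[LHS]fineK; last exact: (integrable_fin_num _ int_diff).
    congr _%:E; apply/eqP; rewrite eq_le; apply/andP; split; first exact: I0.
    by apply: fine_ge0; apply: integral_ge0 => t _; rewrite lee_fin modulus_ge0.
  have md : measurable_fun setT (fun t => (modulus (fn l t + emb (- g t)))%:E).
    by apply/measurable_EFinP; exact: measurable_modulus.
  have := (ae_eq_integral_abs mu01 measurableT md).1 I0'.
  apply: filterS => t /(_ I) [] /modulus_eq0; rewrite embN => /eqP.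
  by rewrite subr_eq0 => /eqP.
split; first by split => //; exists l.
rewrite (cone_normE ri lg).
apply/ler_addgt0Pl => r r0; have [n [n1 _]] := approx _ r0.
have vn : vnorm (v n) <= \int[mu01]_t g t.
  rewrite -(cone_normE ri (rv n)); apply: (le_trans (bounded_norm (mh n) (hn n)).2).
  exact: le_Rintegral.
have := vnormD (l - v n) (v n); rewrite subrK; lra.
Qed.

Lemma equals_L1_of_bounded : equals_L1 fn.
Proof.
split.
  apply/seteqP; split => F /=.
    move=> [mF [x xF]]; apply/(kintegrableP mF).
    exact: (repr_int ri xF mF).1.
  move=> iF; have mF := kintegrable_measurable iF.
  have [cg _] := integrable_cone ((kintegrableP mF).1 iF) (fun t => modulus_ge0 (F t)).
  split => //.
  have [y yF _] : exists2 y, repr y F & vnorm y <= vnorm (class (fun t => modulus (F t))).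
    apply: (repr_ideal ri (classP cg) mF); apply: aeW => t.
    by rewrite modulus_emb ger0_norm ?modulus_ge0.
  by exists y.
move=> x; apply/eqP; rewrite eq_le (ri_L1 ri x).2 andbT.
have [xi _] := repr_int ri (repr_self fn x) (fn_measurable ri x).
have [_ ] := integrable_cone xi (fun t => modulus_ge0 (fn x t)).
have -> : cone_norm (fun t => modulus (fn x t)) = vnorm x by exact: (absf_cone ri x).2.
rewrite -lee_fin => h; apply: (le_trans h).
by rewrite Lpnorm1E /Rintegral fineK//; exact: integrable_fin_num.
Qed.

End EqualsL1.

Theorem theorem4p2 (R : realType) (k : scalar_kind)
  (X : completeNormedModType (scalars_of R k))
  (fn : X -> measurableTypeR R -> scalars_of R k) :
  ri_space fn -> separable X -> lush X -> equals_L1 fn.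
Proof.
move=> ri sepX lushX.
have snE : symmetric_norm (cone fn) (cone_norm fn).
  split.
  - by move=> f [].
  - by move=> f [].
  - by move=> f g; exact: (cone_solid ri).
  - by move=> f g; exact: (cone_add ri).
  - by move=> c f; exact: (cone_scale ri).
  - exact: (cone_one ri).
  - by move=> f; exact: (cone_L1 ri).
  - by move=> tau; exact: (cone_symmetric ri).
  - exact: (separable_abs_cont ri sepX).
have norm_indic A := @lush_cone_indic R _ _ snE A (lush_function_space ri lushX).
apply: (equals_L1_of_bounded ri) => f M mf fM; split; first exact: (E_bounded snE mf fM).
exact: (rho_le_integral_bounded snE norm_indic mf fM).
Qed.
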